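(* Let $\Gamma$ be a primitive distance-regular graph with diameter $D\geq 3$, and let $G$ be the $4D\times 4D$ matrix of inner products (Gram matrix) of the $4D$ matrices $$A_2E_i^*A-AE_i^*A_2,\qquad A_3E_i^*-E_i^*A_3,\qquad A_2E_i^*-E_i^*A_2,\qquad AE_i^*-E_i^*A\qquad (1\leq i\leq D).$$ Then $\Gamma$ is $Q$-polynomial if and only if $\det(G)=0$.
   Context: Let $\Gamma=(X,R)$ be a finite, undirected, connected graph without loops or multiple edges, with vertex set $X$, path-length distance function $\partial$ and diameter $D=\max\{\partial(x,y): x,y\in X\}$. For $x\in X$ let $\Gamma_i(x)=\{y\in X:\partial(x,y)=i\}$. $\Gamma$ is distance-regular if for all $0\leq h,i,j\leq D$ and all $x,y\in X$ with $\partial(x,y)=h$ the number $p^h_{ij}=|\Gamma_i(x)\cap\Gamma_j(y)|$ depends only on $h,i,j$. $\Gamma$ is primitive if for every $1\leq i\leq D$ the graph with vertex set $X$, in which two vertices are adjacent iff they are at distance $i$ in $\Gamma$, is connected. Matrices are in $\mathrm{Mat}_X(\mathbb{C})$ (rows and columns indexed by $X$), with Hermitean inner product $\langle R,S\rangle=\mathrm{tr}(R^t\overline{S})$. $A_i$ ($0\leq i\leq D$) is the $i$-th distance matrix: $(A_i)_{xy}=1$ if $\partial(x,y)=i$ and $0$ otherwise; $A=A_1$. Fix a vertex $x\in X$. For $0\leq i\leq D$, $E_i^*=E_i^*(x)$ is the diagonal matrix with $(y,y)$-entry $1$ if $\partial(x,y)=i$ and $0$ otherwise. The Bose-Mesner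 algebra $M$ is the subalgebra of $\mathrm{Mat}_X(\mathbb{C})$ generated by $A$; it has basis $A_0,\dots,A_D$. It also has a basis of primitive idempotents $E_0,\dots,E_D$ (real symmetric, $E_iE_j=\delta_{ij}E_i$, $\sum_i E_i=I$), with $E_0=|X|^{-1}J$, $J$ the all-ones matrix. With $\circ$ the entrywise product, the Krein parameters $q^h_{ij}$ are defined by $E_i\circ E_j=|X|^{-1}\sum_{h=0}^D q^h_{ij}E_h$. $\Gamma$ is $Q$-polynomial with respect to an ordering $E_0,E_1,\dots,E_D$ of the primitive idempotents (with $E_0=|X|^{-1}J$) if for all $0\leq h,i,j\leq D$: (i) $q^h_{ij}=0$ if one of $h,i,j$ is greater than the sum of the other two; (ii) $q^h_{ij}\neq 0$ if one of $h,i,j$ equals the sum of the other two. $\Gamma$ is $Q$-polynomial if it is $Q$-polynomial with respect to some such ordering. *)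

(* Defs.v *)
From HB Require Import structures.
From mathcomp Require Import all_boot all_order all_algebra.
From mathcomp Require Import complex reals.

Set Implicit Arguments.
Unset Strict Implicit.
Unset Printing Implicit Defensive.

Import Order.TTheory GRing.Theory Num.Theory.

Section Graph.
Variables (T : finType) (e : rel T).

Definition connected_simple_graph : Prop :=
  [/\ symmetric e, irreflexive e & forall x y, connect e x y].

(* Length of a shortest e-path from x to y. A shortest path has fewer than
   #|T| edges, so the search range suffices when x and y are connected (and
   the value is #|T| when they are not); see dist_le_path and dist_path. *)
Definition dist (x y : T) : nat :=
  find (fun n => [exists p : n.-tuple T, path e x p && (last x p == y)])
       (iota 0 #|T|).

Definition diameter : nat := \max_(x : T) \max_(y : T) dist x y.

Definition sphere (i : nat) (x : T) : {set T} := [set y | dist x y == i].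

Definition distance_regular : Prop :=
  exists p : nat -> nat -> nat -> nat,
  forall h i j, h <= diameter -> i <= diameter -> j <= diameter ->
  forall x y, dist x y = h -> #|sphere i x :&: sphere j y| = p h i j.

Definition primitive : Prop :=
  forall i, 1 <= i <= diameter ->
  forall x y, connect [rel u v | dist u v == i] x y.

Lemma dist_le_path x p : path e x p -> dist x (last x p) <= size p.
Proof.
move=> ep; rewrite leqNgt; apply/negP => lt_p.
have lt_pT : size p < #|T|.
  by apply: leq_trans lt_p _; rewrite -[X in _ <= X](size_iota 0) find_size.
have /= := before_find 0 lt_p.
rewrite nth_iota // add0n => /existsP[]; exists (in_tuple p).
by rewrite /= ep eqxx.
Qed.

Lemma dist_path x y : connect e x y ->
  exists p, [/\ path e x p, last x p = y & size p = dist x y].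
Proof.
case/connectP => p0 ep0 ->; case/shortenP: ep0 => p ep up _.
pose P n := [exists q : n.-tuple T, path e x q && (last x q == last x p)].
have hasP : has P (iota 0 #|T|).
  apply/hasP; exists (size p).
    rewrite mem_iota add0n; apply: leq_trans (max_card [in x :: p]).
    by rewrite (card_uniqP up).
  by apply/existsP; exists (in_tuple p); rewrite /= ep eqxx.
have lt_f : find P (iota 0 #|T|) < #|T|.
  by move: hasP; rewrite has_find size_iota.
have := nth_find 0 hasP; rewrite (nth_iota _ _ lt_f) add0n.
case/existsP => q /andP[eq /eqP lq].
by exists q; split=> //; rewrite size_tuple.
Qed.

End Graph.

Local Open Scope ring_scope.

Section Matrices.
Variables (C : numClosedFieldType) (T : finType) (e : rel T).

(* Mat_X(C): the vertex set T is identified with 'I_#|T| through enum_val. *)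
Local Notation MatX := ('M[C]_#|T|).
Local Notation D := (diameter e).

Definition dist_mx (i : nat) : MatX :=
  \matrix_(y, z) (dist e (enum_val y) (enum_val z) == i)%:R.

Definition dual_idem (x : T) (i : nat) : MatX :=
  \matrix_(y, z) ((y == z) && (dist e x (enum_val y) == i))%:R.

Definition mx_inner (R S : MatX) : C := \tr (R^T *m map_mx Num.conj S).

(* The (unital) subalgebra of Mat_X(C) generated by the adjacency matrix. *)
Inductive bose_mesner : MatX -> Prop :=
| BM_one : bose_mesner 1%:M
| BM_adj : bose_mesner (dist_mx 1)
| BM_lin (a : C) (R S : MatX) :
    bose_mesner R -> bose_mesner S -> bose_mesner (a *: R + S)
| BM_mul (R S : MatX) :
    bose_mesner R -> bose_mesner S -> bose_mesner (R *m S).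

(* E lists (in some order, except for E_0 = |X|^-1 J) the basis of primitive
   idempotents of the Bose-Mesner algebra. *)
Record primitive_idempotents (E : 'I_D.+1 -> MatX) : Prop :=
  PrimitiveIdempotents {
    pi_free : free (codom E);
    pi_span : forall B : MatX, bose_mesner B <-> B \in <<codom E>>%VS;
    pi_real : forall i y z, E i y z \is Num.real;
    pi_sym : forall i, (E i)^T = E i;
    pi_orth : forall i j, E i *m E j = if i == j then E i else 0;
    pi_sum : \sum_i E i = 1%:M;
    pi_0 : E ord0 = (#|T|%:R)^-1 *: const_mx 1 }.

(* q h i j stands for q^h_{ij}; it is determined by E since the E_h are
   linearly independent. *)
Definition krein_parameters (E : 'I_D.+1 -> MatX)
    (q : 'I_D.+1 -> 'I_D.+1 -> 'I_D.+1 -> C) : Prop :=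
  forall i j, map2_mx *%R (E i) (E j) = (#|T|%:R)^-1 *: \sum_h q h i j *: E h.

Definition Q_polynomial_wrt (E : 'I_D.+1 -> MatX) : Prop :=
  exists2 q, krein_parameters E q &
  forall h i j : 'I_D.+1,
    ([|| i + j < h, h + j < i | h + i < j]%N -> q h i j = 0) /\
    ([|| h == i + j :> nat, i == h + j :> nat | j == h + i :> nat]%N ->
       q h i j != 0).

Definition Q_polynomial : Prop :=
  exists2 E : 'I_D.+1 -> MatX, primitive_idempotents E & Q_polynomial_wrt E.

Definition gram_family (x : T) : seq MatX :=
  let A := dist_mx 1 in let A2 := dist_mx 2 in let A3 := dist_mx 3 in
  let Es := dual_idem x in
  [seq A2 *m Es i *m A - A *m Es i *m A2 | i <- iota 1 D] ++
  [seq A3 *m Es i - Es i *m A3 | i <- iota 1 D] ++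
  [seq A2 *m Es i - Es i *m A2 | i <- iota 1 D] ++
  [seq A *m Es i - Es i *m A | i <- iota 1 D].

Definition gram (x : T) : 'M[C]_(4 * D) :=
  \matrix_(k, l) mx_inner (gram_family x)`_k (gram_family x)`_l.

End Matrices.

(* Main.v *)
Require Import Defs.
From HB Require Import structures.
From mathcomp Require Import all_boot all_order all_algebra.
From mathcomp Require Import fingroup perm spectral complex reals.
From mathcomp Require Import ring zify.

Set Implicit Arguments.
Unset Strict Implicit.
Unset Printing Implicit Defensive.

Import Order.TTheory GRing.Theory Num.Theory.
Local Open Scope ring_scope.

(* Write A* for a diagonal matrix whose (y, y)-entry is a function of the
   distance from x to y. A linear dependence between the given matrices is a
   relation
     (A_2 B* A - A B* A_2) + [A_3, C*] + [A_2, F*] + [A, H*] = 0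
   with B*, C*, F*, H* of this kind and not all scalar.

   If E_0, ..., E_D is a Q-polynomial ordering, let A* be the diagonal matrix
   given by the row x of E_1. Then E_i A* E_j = 0 for |i - j| > 1, so that
   A_2 A* A - A A* A_2 is a commutator [V, A*] with V in the Bose-Mesner
   algebra; comparing entries at each distance only A_1, A_2, A_3 contribute to
   V, and this is a linear dependence.

   Conversely, expand B*, C*, F*, H* in the dual matrices A*_h given by the
   row x of E_h. The matrices E_i A*_h E_j with nonzero Krein parameter q^h_ij
   are orthogonal, so for each h the coefficients (b, c, f, g) of A*_h satisfy
     b (p2(s) u - s p2(u)) + c (p3(s) - p3(u)) + f (p2(s) - p2(u)) + g (s - u) = 0
   for the eigenvalues s, u of E_i, E_j whenever q^h_ij <> 0, where A_2 = p2(A)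
   and A_3 = p3(A). Take h <> 0 with (b, c, f, g) <> 0. Entries of the relation
   in the row x and primitivity give c <> 0, so the left side is cubic in u and
   i has at most two neighbours in the graph on {0, ..., D} where i, j are
   adjacent when i <> j and q^h_ij <> 0. By primitivity this graph is connected,
   and 0 has the only neighbour h, so it is a path: a Q-polynomial ordering. *)

(** * Linear algebra, paths and structure constants *)

Lemma span_codomP (K : fieldType) (vT : vectType K) n (X : 'I_n -> vT) v :
  reflect (exists c : 'I_n -> K, v = \sum_i c i *: X i) (v \in <<codom X>>%VS).
Proof.
rewrite span_def big_map big_enum /=.
apply: (iffP memv_sumP) => [[vs vsP ->]|[c ->]].
  exists (fun i => sval (sig_eqW (vlineP _ _ (vsP i isT)))).
  by apply: eq_bigr => i _; case: sig_eqW.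
by exists (fun i => c i *: X i) => // i _; rewrite memvZ ?memv_line.
Qed.

Lemma free_codomP (K : fieldType) (vT : vectType K) n (X : 'I_n -> vT) :
  reflect (forall c : 'I_n -> K, \sum_i c i *: X i = 0 -> forall i, c i = 0)
          (free (codom X)).
Proof.
have -> : free (codom X) = free (mktuple X) by [].
apply: (iffP freeP) => H c Hc; apply: H; rewrite -[RHS]Hc.
  by apply: eq_bigr => i _; rewrite -tnth_nth tnth_mktuple.
by apply: eq_bigr => i _; rewrite -tnth_nth tnth_mktuple.
Qed.

(** A simple path from [ord0] is extended vertex by vertex. Its non-final vertices already have all
    their neighbours on the path, so by connectedness the last vertex has a neighbour outside until
    all vertices are used; the order along the path is the permutation. *)
Lemma path_ordering n (e : rel 'I_n.+1) :
    symmetric e -> irreflexive e ->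
    (forall S : {set 'I_n.+1}, ord0 \in S ->
       (forall u v, u \in S -> e u v -> v \in S) -> S = setT) ->
    (forall u v1 v2 v3, e u v1 -> e u v2 -> e u v3 -> ~~ uniq [:: v1; v2; v3]) ->
    (forall v1 v2, e ord0 v1 -> e ord0 v2 -> v1 = v2) ->
  exists2 s : 'S_n.+1, s ord0 = ord0 &
    forall i j : 'I_n.+1, e (s i) (s j) = (i == j.+1 :> nat) || (j == i.+1 :> nat).
Proof.
move=> e_sym eirr conn deg deg0.
pose nt := nth (@ord0 n).
(* A vertex at position [a.+1] already has the neighbours at positions [a] and [a.+2], so by the
   degree bound a third one coincides with one of them. *)
have succ_nbr (p : seq 'I_n.+1) a v : uniq (ord0 :: p) -> path e ord0 p ->
    (a < size p)%N -> e (nt (ord0 :: p) a) v ->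
    v = nt (ord0 :: p) a.+1 \/ (0 < a)%N /\ v = nt (ord0 :: p) a.-1.
  move=> up /(pathP ord0) ep lta eav; case: a => [|a] in lta eav *.
    by left; apply: deg0 eav (ep 0 lta).
  have eprev : e (nt (ord0 :: p) a.+1) (nt (ord0 :: p) a).
    by rewrite e_sym; apply: ep a (ltnW lta).
  have := deg _ _ _ _ eav (ep a.+1 lta) eprev.
  rewrite [uniq _]/=.
  rewrite !inE andbT negb_and !negbK => /orP[/orP[]|] /eqP; [by left|by right|].
  move/eqP; rewrite (nth_uniq ord0 (s := ord0 :: p) (i := a.+2) (j := a)) //=; last first.
    by do 2 apply: ltnW.
  by lia.
have grow m : (m <= n)%N ->
    exists p : seq 'I_n.+1, [/\ uniq (ord0 :: p), path e ord0 p & size p = m].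
  elim: m => [|m IH] lemn; first by exists [::].
  have [p [up ep sp]] := IH (ltnW lemn).
  suff [v [vp ev]] : exists v, v \notin ord0 :: p /\ e (last ord0 p) v.
    exists (rcons p v); split; last by rewrite size_rcons sp.
      by rewrite -rcons_cons rcons_uniq vp.
    by rewrite rcons_path ep.
  (* A path closed under adjacency would contain all [n.+1] vertices, but it has only
     [m.+1 <= n]. *)
  have [all_in|] := boolP [forall u in ord0 :: p, forall v, e u v ==> (v \in ord0 :: p)].
    have SE : [set u in ord0 :: p] = setT.
      apply: conn => [|u v]; rewrite inE ?inE ?eqxx // [v \in _]inE => u1p euv.
      by move: all_in => /forall_inP/(_ u u1p)/forallP/(_ v)/implyP; apply.
    have: #|[set u in ord0 :: p]| = n.+1 by rewrite SE cardsT card_ord.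
    by rewrite cardsE (card_uniqP up) /= sp; lia.
  rewrite negb_forall_in => /exists_inP[u up' /forallPn[v]].
  rewrite negb_imply => /andP[euv vp]; exists v; split=> //.
  suff -> : last ord0 p = u by [].
  have lt_iu : (index u (ord0 :: p) < (size p).+1)%N.
    by rewrite -[X in (_ < X)%N]/(size (ord0 :: p)) index_mem.
  (* The vertex [u] with a neighbour off the path must be the last one: from any earlier position
     [succ_nbr] puts [v] on the path. *)
  move: euv; rewrite -{1 2}[u](nth_index ord0 up') => euv.
  have [lt|ge] := ltnP (index u (ord0 :: p)) (size p).
    have inp k : (k <= size p)%N -> nt (ord0 :: p) k \in ord0 :: p.
      by move=> lek; apply: mem_nth.
    have [vE|[_ vE]] := succ_nbr _ _ _ up ep lt euv; rewrite vE inp // in vp.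
    by apply: leq_trans (leq_pred _) _.
  rewrite (last_nth ord0) -(_ : index u (ord0 :: p) = size p) ?nth_index //; lia.
have [p [up ep sp]] := grow n (leqnn n).
have inj_s : injective (fun i : 'I_n.+1 => nt (ord0 :: p) i).
  move=> i j /eqP; rewrite nth_uniq //= ?sp ?ltn_ord //.
  by rewrite val_eqE => /eqP.
exists (perm inj_s) => [|i j]; first by rewrite permE.
rewrite !permE; apply/idP/idP; last first.
  have step (k l : 'I_n.+1) : k = l.+1 :> nat -> e (nt (ord0 :: p) l) (nt (ord0 :: p) k).
    by move=> kl; rewrite kl; apply: (pathP ord0 ep); rewrite sp; have := ltn_ord k; lia.
  by case/orP => /eqP H; [rewrite e_sym|]; apply: step.
wlog lij : i j / (i < j)%N => [W|].
  case: (ltngtP i j) => [|lt|/val_inj ->]; [exact: W| |by rewrite eirr].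
  by rewrite e_sym orbC; apply: W.
move=> eij; have lti : (i < size p)%N by rewrite sp; have := ltn_ord j; lia.
have [vE|[i0 vE]] := succ_nbr _ _ _ up ep lti eij.
- by move/eqP: vE; rewrite nth_uniq //= ?sp ?ltn_ord // => ->; rewrite orbT.
- by move/eqP: vE; rewrite nth_uniq //= ?sp ?ltn_ord //; lia.
Qed.

Lemma mx_inner_eq0 (C : numClosedFieldType) (T : finType) (S : 'M[C]_#|T|) :
  mx_inner S S = 0 -> S = 0.
Proof.
rewrite /mx_inner /mxtrace => S0; apply/matrixP => i j; rewrite mxE.
have ge0 k l : 0 <= S k l * (S k l)^* by rewrite mul_conjC_ge0.
have S0' : \sum_l \sum_k S k l * (S k l)^* = 0.
  rewrite -[RHS]S0; apply: eq_bigr => l _; rewrite !mxE.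
  by apply: eq_bigr => k _; rewrite !mxE.
have /eqP := @psumr_eq0P _ _ _ _ (fun l _ => sumr_ge0 _ (fun k _ => ge0 k l)) S0' j isT.
rewrite psumr_eq0 // => /allP/(_ i); rewrite mem_index_enum => /(_ isT) /=.
by rewrite mul_conjC_eq0 => /eqP.
Qed.

(** A vector in the kernel of the Gram matrix gives a combination orthogonal to every [F_k], hence
    to itself, so it is zero by positive definiteness. *)
Lemma gram_det0P (C : numClosedFieldType) (T : finType) m
    (F : seq 'M[C]_#|T|) :
  \det (\matrix_(k < m, l < m) mx_inner F`_k F`_l) = 0 <->
  exists2 u : 'I_m -> C, \sum_k u k *: F`_k = 0 & exists k, u k != 0.
Proof.
have inner_suml (u : 'I_m -> C) S :
    mx_inner (\sum_k u k *: F`_k) S = \sum_k u k * mx_inner F`_k S.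
  rewrite /mx_inner linear_sum /= mulmx_suml raddf_sum /=.
  by apply: eq_bigr => k _; rewrite linearZ /= -scalemxAl mxtraceZ.
have inner_sumr (u : 'I_m -> C) S :
    mx_inner S (\sum_k u k *: F`_k) = \sum_k (u k)^* * mx_inner S F`_k.
  rewrite /mx_inner raddf_sum /= mulmx_sumr raddf_sum /=.
  by apply: eq_bigr => k _; rewrite map_mxZ -scalemxAr mxtraceZ.
split=> [/eqP/det0P[v nz_v vG]|[u uF [k nz_uk]]].
  exists (v 0); last by case/rV0Pn: nz_v => k; exists k.
  apply: mx_inner_eq0; rewrite inner_sumr big1 // => l _; rewrite inner_suml.
  have /rowP/(_ l) := vG; rewrite !mxE => vGl.
  by rewrite (eq_bigr (fun k => v 0 k * (\matrix_(k, l) mx_inner F`_k F`_l) k l))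
     ?vGl ?mulr0 // => k _; rewrite mxE.
apply/eqP/det0P; exists (\row_k u k).
  by apply/rV0Pn; exists k; rewrite mxE.
apply/rowP => l; rewrite !mxE (eq_bigr (fun k => u k * mx_inner F`_k F`_l)).
  by rewrite -inner_suml uF /mx_inner trmx0 mul0mx mxtrace0.
by move=> i _; rewrite !mxE.
Qed.

(* q i j l stands for the coefficient of the l-th basis vector in the product
   of the i-th and the j-th one: if the first one acts tridiagonally, the i-th
   basis vector is a polynomial of degree i in it. *)
Lemma tridiagonal_structure_constants (K : fieldType) n (n0 : (0 < n)%N)
    (q : 'I_n.+1 -> 'I_n.+1 -> 'I_n.+1 -> K) (one : 'I_n.+1 := inord 1) :
    (forall i j l, q i j l = q j i l) ->
    (forall i j l, (q i j l == 0) = (q i l j == 0)) ->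
    (forall i j k s, \sum_l q i j l * q l k s = \sum_l q i k l * q l j s) ->
    (forall j l, (q ord0 j l != 0) = (j == l)) ->
    (forall i l, i != l ->
       (q one i l != 0) = (i == l.+1 :> nat) || (l == i.+1 :> nat)) ->
  forall h i j : 'I_n.+1,
    ([|| i + j < h, h + j < i | h + i < j]%N -> q i j h = 0) /\
    ([|| h == (i + j)%N :> nat, i == (h + j)%N :> nat | j == (h + i)%N :> nat]%N ->
       q i j h != 0).
Proof.
move=> qC qS qA q0 q1'.
have q1 (i l : 'I_n.+1) : (i != l :> nat) ->
    (q one i l != 0) = (i == l.+1 :> nat) || (l == i.+1 :> nat).
  by move=> nil; apply: q1'.
have main m : forall i : 'I_n.+1, (i <= m)%N -> forall j s : 'I_n.+1,
    ((i + j < s)%N -> q i j s = 0) /\ (s = (i + j)%N :> nat -> q i j s != 0).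
  elim: m => [|m IH] i lim j s.
    have -> : i = ord0 by apply/val_inj => /=; lia.
    by split=> /= [lt|eq]; [apply/eqP/negbNE; rewrite q0|rewrite q0];
       rewrite -val_eqE /=; lia.
  case: (leqP i m) => [/IH|]; first exact.
  move=> lt_mi; have Ei : i = m.+1 :> nat by lia.
  have lemn : (m < n.+1)%N by have := ltn_ord i; lia.
  pose i' := Ordinal lemn.
  have oneE : one = 1 :> nat by rewrite inordK.
  have nz1 : q one i' i != 0 by rewrite q1 ?Ei /=; lia.
  (* Both sides come from the associativity identity for [i'], [one], [j]. On the left, the terms
     with [l <= m] vanish by induction and those with [l > i] by tridiagonality. On the right,
     [l > i' + j] vanishes by induction and [l < i' + j] by tridiagonality. *)
  have key (Hs : (i + j <= s)%N) : q one i' i * q i j s =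
      \sum_(l : 'I_n.+1 | l == (i' + j)%N :> nat) q i' j l * q one l s.
    have := qA i' one j s; rewrite (bigD1 i) //= big1 ?addr0 => [|l nli]; last first.
      have [->|nl] := eqVneq l i'; first by rewrite (IH i' _ j s).1 ?mulr0 //=; lia.
      have [ltl|] := leqP l m; first by rewrite (IH l ltl j s).1 ?mulr0 //; lia.
      move=> ltl; suff /eqP -> : q i' one l == 0 by rewrite mul0r.
      rewrite qC -[_ == _]negbK q1;
      by move: nli nl ltl; rewrite -!val_eqE /=; lia.
    rewrite qC => ->; rewrite [RHS]big_mkcond; apply: eq_bigr => l _.
    case: eqP => [|nl]; first by rewrite (qC l).
    have /= [lt|ge] := ltnP (i' + j) l; first by rewrite (IH i' _ j l).1 ?mul0r.
    suff /eqP -> : q l one s == 0 by rewrite mulr0.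
    rewrite qC -[_ == _]negbK q1 /=; lia.
  split=> [lt|eq]; last first.
    have : q one i' i * q i j s != 0; last by rewrite mulf_eq0 => /norP[].
    have ltn : (i' + j < n.+1)%N by have := ltn_ord s; rewrite /=; lia.
    rewrite key ?eq // (big_pred1 (Ordinal ltn)) //.
    rewrite mulf_neq0 // ?(IH i' _ j _).2 // q1 /=; lia.
  have /eqP := key (ltnW lt); rewrite big1 => [|l /eqP/= lE].
    by rewrite mulf_eq0 (negPf nz1) => /eqP.
  suff /eqP -> : q one l s == 0 by rewrite mulr0.
  rewrite -[_ == _]negbK q1 /=; lia.
move=> h i j; have M (a : 'I_n.+1) b c := main a a (leqnn a) b c.
(* Vanishing of [q] is invariant under all permutations of the three indices, so the other four
   cases reduce to [main]. *)
have swap1 : (q i j h == 0) = (q h j i == 0) by rewrite qC qS qC.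
have swap2 : (q i j h == 0) = (q i h j == 0) by rewrite qS.
split=> /or3P[] H.
- exact: (M _ _ _).1.
- by apply/eqP; rewrite swap1; apply/eqP/(M _ _ _).1.
- by apply/eqP; rewrite swap2; apply/eqP/(M _ _ _).1; rewrite addnC.
- by apply: (M _ _ _).2; apply/eqP.
- by rewrite swap1; apply: (M _ _ _).2; apply/eqP.
- by rewrite swap2; apply: (M _ _ _).2; rewrite addnC; apply/eqP.
Qed.

(** * Distances in a connected graph *)

Section Distance.
Variables (T : finType) (e : rel T).
Hypothesis He : connected_simple_graph e.

Lemma distxx x : dist e x x = 0%N.
Proof. by apply/eqP; rewrite -leqn0 (@dist_le_path _ e x [::]). Qed.

Lemma dist_shortest x y :
  exists p, [/\ path e x p, last x p = y & size p = dist e x y].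
Proof. by case: He => _ _ /(_ x y)/dist_path. Qed.

Lemma dist_eq0 x y : (dist e x y == 0%N) = (x == y).
Proof.
apply/eqP/eqP => [d0|->]; last exact: distxx.
by have [p [_ pE]] := dist_shortest x y; rewrite d0; case: p pE.
Qed.

Lemma dist_sym x y : dist e x y = dist e y x.
Proof.
suff le u v : (dist e u v <= dist e v u)%N by apply/eqP; rewrite eqn_leq !le.
have [p [ep <- <-]] := dist_shortest v u; set q := rev (belast v p).
have -> : size p = size q by rewrite size_rev size_belast.
have eq_ : path e (last v p) q.
  by rewrite rev_path; case: He => es _ _; rewrite (eq_path (e' := e)).
have {2}<- : last (last v p) q = v; last exact: dist_le_path.
by rewrite /q; case: (p) => //= a s; rewrite rev_cons last_rcons.
Qed.

Lemma dist_triangle y x z : (dist e x z <= dist e x y + dist e y z)%N.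
Proof.
have [p [ep pE <-]] := dist_shortest x y; have [q [eq qE <-]] := dist_shortest y z.
rewrite -size_cat -[z]qE -[in last y q]pE -last_cat; apply: dist_le_path.
by rewrite cat_path ep pE.
Qed.

Lemma dist_le_diameter x y : (dist e x y <= diameter e)%N.
Proof. exact: leq_trans (leq_bigmax y) (@leq_bigmax _ (fun x => \max_y dist e x y)%N x). Qed.

Lemma dist_step x y h : dist e x y = h.+1 ->
  exists w, dist e x w = 1%N /\ dist e w y = h.
Proof.
move=> dxy; have [[|w p] [/= ep pE]] := dist_shortest x y; rewrite dxy // => -[sp].
case/andP: ep => exw ep; exists w.
have le1 : (dist e x w <= 1)%N by apply: (@dist_le_path _ e x [:: w]); rewrite /= exw.
have le2 : (dist e w y <= h)%N by rewrite -pE -sp; apply: dist_le_path.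
by have := dist_triangle w x y; rewrite dxy; lia.
Qed.

(** Descent from a pair at distance D: one step along a shortest path lowers the distance by one. *)
Lemma dist_onto (x0 : T) h : (h <= diameter e)%N -> exists x y, dist e x y = h.
Proof.
move=> leh; rewrite -(subKn leh); elim: (_ - h)%N => [|m [x [y IH]]].
  rewrite subn0.
  have [|x xE] := @bigop.eq_bigmax _ (fun x => \max_y dist e x y)%N.
    by apply/card_gt0P; exists x0.
  have [|y yE] := @bigop.eq_bigmax _ (fun y => dist e x y).
    by apply/card_gt0P; exists x0.
  by exists x, y; rewrite /diameter xE yE.
rewrite subnS; case E : (_ - m)%N => [|k]; first by exists x0, x0; rewrite distxx.
by rewrite E in IH; have [w [_ wE]] := dist_step IH; exists w, y.
Qed.

End Distance.

(** * Intersection numbers and the Bose-Mesner algebra *)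

Section BoseMesner.
Variables (C : numClosedFieldType) (T : finType) (e : rel T).
Hypothesis He : connected_simple_graph e.
Variable p : nat -> nat -> nat -> nat.
Local Notation D := (diameter e).
Hypothesis Hp : forall h i j, (h <= D)%N -> (i <= D)%N -> (j <= D)%N ->
  forall x y, dist e x y = h -> #|sphere e i x :&: sphere e j y| = p h i j.
Variable x0 : T.

Local Notation A := (dist_mx C e).
Local Notation BM := (@bose_mesner C T e).
Local Notation d y z := (dist e (enum_val y) (enum_val z)).

Lemma intersection_number y z i j : (i <= D)%N -> (j <= D)%N ->
  #|sphere e i y :&: sphere e j z| = p (dist e y z) i j.
Proof. by move=> iD jD; apply: Hp => //; apply: dist_le_diameter. Qed.

(** All spheres of radius [h] have the same size [p 0 h h], and some sphere of this radius is
    nonempty. *)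
Lemma sphere_neq0 x h : (h <= D)%N -> exists z, dist e x z = h.
Proof.
move=> hD; have [y [z yz]] := dist_onto He x hD.
have := @intersection_number x x h h hD hD; rewrite setIid (distxx e).
rewrite -(distxx e y) -(intersection_number y y hD hD) setIid => eq_card.
have : (0 < #|sphere e h x|)%N.
  by rewrite eq_card; apply/card_gt0P; exists z; rewrite inE yz.
by case/card_gt0P => w; rewrite inE => /eqP; exists w.
Qed.

Lemma intersection_number_eq0 h i j :
  (h <= D)%N -> (i <= D)%N -> (j <= D)%N ->
  (i + j < h)%N || (h + i < j)%N -> p h i j = 0%N.
Proof.
move=> hD iD jD lt; have [z xz] := sphere_neq0 x0 hD.
rewrite -xz -(intersection_number _ _ iD jD); apply/eqP; rewrite cards_eq0.
apply/eqP/setP => w; rewrite !inE; apply/negbTE/negP => /andP[/eqP xw /eqP zw].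
have := dist_triangle He w x0 z; have := dist_triangle He x0 w z.
by move: lt; rewrite (dist_sym He w z) (dist_sym He w x0) xw zw xz; lia.
Qed.

Lemma intersection_numberC h i j :
  (h <= D)%N -> (i <= D)%N -> (j <= D)%N -> p h i j = p h j i.
Proof.
move=> hD iD jD; have [z xz] := sphere_neq0 x0 hD.
have zx : dist e z x0 = h by rewrite (dist_sym He).
by rewrite -{1}xz -{1}zx -!intersection_number // setIC.
Qed.

Lemma intersection_number_neq0 h : (h < D)%N ->
  p h.+1 1 h != 0%N /\ p h.+1 h 1 != 0%N.
Proof.
move=> hD; have [z xz] := sphere_neq0 x0 hD.
have D1 : (1 <= D)%N by lia.
have [w [xw wz]] := dist_step He xz.
have {1}<- := xz; have <- : dist e z x0 = h.+1 by rewrite (dist_sym He).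
rewrite -!intersection_number ?(ltnW hD) // -!lt0n.
by split; apply/card_gt0P; exists w;
  rewrite !inE ?xw ?wz ?(dist_sym He z) wz ?(dist_sym He _ x0) ?xw ?eqxx.
Qed.

Lemma valency_neq0 : (1 <= D)%N -> p 0 1 1 != 0%N.
Proof.
move=> D1; have := intersection_number x0 x0 D1 D1; rewrite distxx setIid => <-; rewrite -lt0n.
by have [z xz] := sphere_neq0 x0 D1; apply/card_gt0P; exists z; rewrite inE xz.
Qed.

Lemma sum_dist_eq (y z : 'I_#|T|) i j : (i <= D)%N -> (j <= D)%N ->
  \sum_(w : 'I_#|T|) (d y w == i)%:R * (d w z == j)%:R = (p (d y z) i j)%:R :> C.
Proof.
move=> iD jD; rewrite -(intersection_number _ _ iD jD) -sum1_card natr_sum.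
rewrite (reindex_onto enum_rank enum_val) /=; last by move=> w _; rewrite enum_valK.
rewrite [RHS]big_mkcond; apply: eq_big => [w|w _]; first by rewrite enum_rankK eqxx.
by rewrite enum_rankK !inE (dist_sym He (enum_val z)) -natrM mulnb; case: (_ && _).
Qed.

(** General form of an element of the Bose-Mesner algebra; only the values [s h] with [h <= D]
    matter. *)
Definition distance_function (s : nat -> C) : 'M[C]_#|T| := \matrix_(y, z) s (d y z).
Local Notation fmx := distance_function.

Lemma distance_function_sum s : fmx s = \sum_(h < D.+1) s h *: A h.
Proof.
apply/matrixP => y z; rewrite summxE mxE.
have dD : (d y z < D.+1)%N by rewrite ltnS dist_le_diameter.
rewrite (bigD1 (Ordinal dD)) //= big1 => [|h nh]; rewrite !mxE ?eqxx ?mulr1 ?addr0 //.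
by rewrite (_ : (_ == _) = false) ?mulr0 //; apply/negbTE; rewrite eq_sym.
Qed.

Lemma distance_function_mul s t : fmx s *m fmx t =
  fmx (fun h => \sum_(i < D.+1) \sum_(j < D.+1) s i * t j * (p h i j)%:R).
Proof.
rewrite (distance_function_sum s) (distance_function_sum t) mulmx_suml.
apply/matrixP => y z; rewrite summxE [RHS]mxE; apply: eq_bigr => i _.
rewrite mulmx_sumr summxE; apply: eq_bigr => j _.
rewrite -scalemxAl -scalemxAr scalerA mxE -(@sum_dist_eq y z i j) -1?ltnS ?ltn_ord //.
by rewrite !mxE; congr (_ * _); apply: eq_bigr => w _; rewrite !mxE.
Qed.

Lemma distance_function_lin a s t :
  a *: fmx s + fmx t = fmx (fun h => a * s h + t h).
Proof. by apply/matrixP => y z; rewrite !mxE. Qed.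

Lemma distance_function1 : fmx (fun h => (h == 0%N)%:R) = 1%:M.
Proof.
by apply/matrixP => y z; rewrite !mxE dist_eq0 // (inj_eq enum_val_inj).
Qed.

Lemma dist_mxE i : A i = fmx (fun h => (h == i)%:R).
Proof. by apply/matrixP => y z; rewrite !mxE. Qed.

Lemma bose_mesner_distance_function B : BM B -> exists s, B = fmx s.
Proof.
elim=> [||a R S _ [s ->] _ [t ->]|R S _ [s ->] _ [t ->]].
- by eexists; rewrite -distance_function1.
- by eexists; apply: dist_mxE.
- by eexists; apply: distance_function_lin.
- by eexists; apply: distance_function_mul.
Qed.

Lemma bose_mesner0 : BM 0.
Proof.
by rewrite -(addNr 1%:M) -scaleN1r; apply: BM_lin; apply: BM_one.
Qed.

Lemma bose_mesnerZ a B : BM B -> BM (a *: B).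
Proof. by move=> BB; rewrite -[_ *: _]addr0; apply: BM_lin => //; apply: bose_mesner0. Qed.

Lemma bose_mesner_sum (I : Type) (r : seq I) (P : pred I) (F : I -> 'M[C]_#|T|) :
  (forall i, P i -> BM (F i)) -> BM (\sum_(i <- r | P i) F i).
Proof.
move=> BF; apply: big_ind => //; first exact: bose_mesner0.
by move=> R S BR BS; rewrite -[R]scale1r; apply: BM_lin.
Qed.

Lemma dist_mx0 : A 0 = 1%:M.
Proof. by rewrite -distance_function1 dist_mxE. Qed.

Lemma dist_mx_mul i j : (i <= D)%N -> (j <= D)%N ->
  A i *m A j = fmx (fun h => (p h i j)%:R).
Proof.
move=> iD jD; apply/matrixP => y z; rewrite [RHS]mxE -sum_dist_eq // mxE.
by apply: eq_bigr => w _; rewrite !mxE.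
Qed.

(** In the expansion of [A 1 *m A i] the coefficient of [A i.+1] is nonzero and no later distance
    matrix occurs, so [A i.+1] can be solved for by strong induction. *)
Lemma bose_mesner_dist_mx i : (i <= D)%N -> BM (A i).
Proof.
elim/ltn_ind: i => -[|i] IH iD; first by rewrite dist_mx0; apply: BM_one.
have [c_neq0 _] := intersection_number_neq0 iD.
have D1 : (1 <= D)%N by lia.
have iO : (i.+1 < D.+1)%N by [].
have := dist_mx_mul D1 (ltnW iD); rewrite distance_function_sum.
rewrite (bigD1 (Ordinal iO)) //= => /eqP; rewrite -subr_eq eq_sym => /eqP AE.
have -> : A i.+1 = (p i.+1 1 i)%:R^-1 *: ((p i.+1 1 i)%:R *: A i.+1).
  by rewrite scalerA mulVf ?scale1r // pnatr_eq0.
rewrite AE addrC -scaleN1r; apply: bose_mesnerZ; apply: BM_lin; last first.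
  by apply: BM_mul; [exact: BM_adj|apply: IH => //; exact: ltnW].
apply: bose_mesner_sum => h nh; have := ltn_ord h; rewrite ltnS => hD.
have [lt|ge] := ltnP i.+1 h; last first.
  by apply/bose_mesnerZ/IH => //; move: nh ge; rewrite -val_eqE /=; lia.
rewrite intersection_number_eq0 ?scale0r ?add1n ?lt //; first exact: bose_mesner0. by lia.
Qed.

Lemma bose_mesner_of_distance_function s : BM (fmx s).
Proof.
rewrite distance_function_sum; apply: bose_mesner_sum => h _.
by apply/bose_mesnerZ/bose_mesner_dist_mx; rewrite -ltnS.
Qed.

Lemma distance_function_inj s t : fmx s = fmx t -> forall h, (h <= D)%N -> s h = t h.
Proof.
move=> /matrixP st h hD; have [z <-] := sphere_neq0 x0 hD.
by have := st (enum_rank x0) (enum_rank z); rewrite !mxE !enum_rankK.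
Qed.

Lemma dist_mx_square : (2 <= D)%N ->
  A 1 *m A 1 = (p 0 1 1)%:R *: 1%:M + (p 1 1 1)%:R *: A 1 + (p 2 1 1)%:R *: A 2.
Proof.
move=> D2; rewrite dist_mx_mul ?(ltnW D2) // -dist_mx0.
apply/matrixP => y z; rewrite !mxE; have := dist_le_diameter e (enum_val y) (enum_val z).
case: (d y z) => [|[|[|h]]] hD; rewrite /= ?mulr1 ?mulr0 ?addr0 ?add0r //.
by rewrite intersection_number_eq0 // ltnW.
Qed.

(** Together with [dist_mx_square] this makes [A 3] a cubic polynomial in [A 1]; the coefficients
    are the classical b_1, a_2, c_3. *)
Lemma dist_mx_cube : (3 <= D)%N ->
  A 1 *m A 2 = (p 1 1 2)%:R *: A 1 + (p 2 1 2)%:R *: A 2 + (p 3 1 2)%:R *: A 3.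
Proof.
move=> D3; rewrite dist_mx_mul ?(ltnW D3) //; last by lia.
apply/matrixP => y z; rewrite !mxE; have := dist_le_diameter e (enum_val y) (enum_val z).
case E : (d y z) => [|[|[|[|h]]]] hD; rewrite /= ?mulr1 ?mulr0 ?addr0 ?add0r //.
  by rewrite intersection_number_eq0 //; lia.
by rewrite intersection_number_eq0 //; lia.
Qed.

End BoseMesner.

(** * Primitive idempotents, their eigenvalues and entries *)

Lemma primitive_idempotents_perm (C : numClosedFieldType) (T : finType) (e : rel T)
    (E : 'I_(diameter e).+1 -> 'M[C]_#|T|) (s : 'S_(diameter e).+1) :
  s ord0 = ord0 -> primitive_idempotents E -> primitive_idempotents (E \o s).
Proof.
move=> s0 HE; have sum_perm (c : 'I_(diameter e).+1 -> C) :
    \sum_i c i *: (E \o s) i = \sum_i c ((s^-1)%g i) *: E i.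
  by rewrite [RHS](reindex_perm s); apply: eq_bigr => i _; rewrite permK.
split=> /=.
- apply/free_codomP => c; rewrite sum_perm => c0 i.
  by have /free_codomP/(_ _ c0 (s i)) := pi_free HE; rewrite permK.
- move=> B; rewrite (pi_span HE); split=> /span_codomP[c ->]; apply/span_codomP.
    by exists (c \o s); rewrite (reindex_perm s).
  by exists (fun i => c ((s^-1)%g i)); rewrite sum_perm.
- by move=> i; apply: (pi_real HE).
- by move=> i; apply: (pi_sym HE).
- by move=> i j; rewrite (pi_orth HE) (inj_eq perm_inj).
- by rewrite -(pi_sum HE) [RHS](reindex_perm s).
- by rewrite s0 (pi_0 HE).
Qed.

Section Idempotents.
Variables (C : numClosedFieldType) (T : finType) (e : rel T).
Hypothesis He : connected_simple_graph e.
Variable p : nat -> nat -> nat -> nat.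
Local Notation D := (diameter e).
Hypothesis Hp : forall h i j, (h <= D)%N -> (i <= D)%N -> (j <= D)%N ->
  forall x y, dist e x y = h -> #|sphere e i x :&: sphere e j y| = p h i j.
Variable x : T.
Local Notation A := (dist_mx C e).
Local Notation BM := (@bose_mesner C T e).
Local Notation d y z := (dist e (enum_val y) (enum_val z)).
Local Notation fmx := (@distance_function C T e).
Variable E : 'I_D.+1 -> 'M[C]_#|T|.
Hypothesis HE : primitive_idempotents E.

Lemma bose_mesner_idem i : BM (E i).
Proof. by apply/(pi_span HE); apply/memv_span/codom_f. Qed.

Lemma bose_mesnerP B : BM B <-> exists c : 'I_D.+1 -> C, B = \sum_i c i *: E i.
Proof.
by split=> [/(pi_span HE)/span_codomP //|cP]; apply/(pi_span HE)/span_codomP.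
Qed.

Lemma idem_mull (c : 'I_D.+1 -> C) j : (\sum_i c i *: E i) *m E j = c j *: E j.
Proof.
rewrite mulmx_suml (bigD1 j) //= big1 => [|i nij]; rewrite -scalemxAl (pi_orth HE).
  by rewrite eqxx addr0.
by rewrite (negPf nij) scaler0.
Qed.

Lemma idem_mulr (c : 'I_D.+1 -> C) j : E j *m (\sum_i c i *: E i) = c j *: E j.
Proof.
rewrite mulmx_sumr (bigD1 j) //= big1 => [|i nij]; rewrite -scalemxAr (pi_orth HE).
  by rewrite eqxx addr0.
by rewrite eq_sym (negPf nij) scaler0.
Qed.

Lemma idem_neq0 i : E i != 0.
Proof.
apply/eqP => Ei0; have /free_codomP H := pi_free HE.
have sum0 : \sum_j (i == j)%:R *: E j = 0.
  by rewrite big1 // => j _; case: eqP => [<-|_]; rewrite ?scale0r // Ei0 scaler0.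
by have /eqP := H (fun j => (i == j)%:R) sum0 i; rewrite eqxx oner_eq0.
Qed.

Lemma idem_coef_inj (c c' : 'I_D.+1 -> C) :
  \sum_i c i *: E i = \sum_i c' i *: E i -> c =1 c'.
Proof.
move=> cc' i; have := idem_mull c i; rewrite cc' idem_mull => /eqP.
by rewrite -subr_eq0 -scalerBl scaler_eq0 (negPf (idem_neq0 i)) orbF subr_eq0 => /eqP.
Qed.

(** The algebra is generated by [A 1], so with equal eigenvalues every element would act by the same
    scalar on [E i] and on [E j]; but [E i] acts as 1 on the former and as 0 on the latter. *)
Lemma eigenvalue_inj (th : 'I_D.+1 -> C) : A 1 = \sum_i th i *: E i -> injective th.
Proof.
move=> A1 i j thij.
have same B : BM B -> exists b, B *m E i = b *: E i /\ B *m E j = b *: E j.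
  elim=> [||a R S _ [r [Ri Rj]] _ [s [Si Sj]]|R S _ [r [Ri Rj]] _ [s [Si Sj]]].
  - by exists 1; rewrite !mul1mx !scale1r.
  - by exists (th i); rewrite A1 !idem_mull thij.
  - by exists (a * r + s); rewrite !mulmxDl -!scalemxAl Ri Rj Si Sj !scalerA !scalerDl.
  - by exists (s * r); rewrite -!mulmxA Si Sj -!scalemxAr Ri Rj !scalerA.
have [b []] := same _ (bose_mesner_idem i); rewrite !(pi_orth HE) eqxx.
case: eqP => // _ Ei /esym/eqP; rewrite scaler_eq0 (negPf (idem_neq0 j)) orbF => /eqP b0.
by have := idem_neq0 i; rewrite Ei b0 scale0r eqxx.
Qed.

Lemma idem_eq (M : 'M[C]_#|T|) : (forall i j, E i *m M *m E j = 0) -> M = 0.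
Proof.
move=> M0; rewrite -[M]mul1mx -[LHS]mulmx1 -(pi_sum HE) mulmx_sumr big1 // => j _.
by rewrite !mulmx_suml big1.
Qed.

(** Up to the factor |X| this is the dual eigenvalue of [E i] at distance [h]. The default [x] is
    reached only for [h > D]. *)
Definition idem_entry (i : 'I_D.+1) (h : nat) : C :=
  E i (enum_rank x) (enum_rank (odflt x [pick z | dist e x z == h])).

Lemma idem_entryE i y z : E i y z = idem_entry i (d y z).
Proof.
have [s Es] := bose_mesner_distance_function He Hp (bose_mesner_idem i).
rewrite /idem_entry Es !mxE !enum_rankK; congr s.
have [w xw] := sphere_neq0 He Hp x (dist_le_diameter e (enum_val y) (enum_val z)).
by case: pickP => [v /eqP //|/(_ w)]; rewrite xw eqxx.
Qed.

Lemma idem_conj i : map_mx Num.conj (E i) = E i.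
Proof.
by apply/matrixP => y z; rewrite mxE; apply/CrealP/(pi_real HE).
Qed.

Lemma idem_trace i : \tr (E i) = #|T|%:R * idem_entry i 0.
Proof.
rewrite /mxtrace (eq_bigr (fun=> idem_entry i 0)); last first.
  by move=> y _; rewrite idem_entryE distxx.
by rewrite sumr_const card_ord mulr_natl.
Qed.

(** The squared norm of [E i] is its trace, which is |X| times this entry. *)
Lemma idem_entry0_neq0 i : idem_entry i 0 != 0.
Proof.
apply/eqP => Ei0; have := idem_neq0 i; rewrite (@mx_inner_eq0 _ _ (E i)) ?eqxx //.
by rewrite /mx_inner (pi_sym HE) idem_conj (pi_orth HE) eqxx idem_trace Ei0 mulr0.
Qed.

Lemma card_neq0 : #|T|%:R != 0 :> C.
Proof. by rewrite pnatr_eq0 -lt0n; apply/card_gt0P; exists x. Qed.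

Hypothesis Hprim : primitive e.

(** Two rows of [E h] belonging to vertices at distance [r] have squared difference 2 s_0 - 2 s_r.
    If this is zero, primitivity makes all rows equal, so [E h] is a multiple of [E ord0], which
    contradicts orthogonality. *)
Lemma idem_entry_neq h r : h != ord0 -> (1 <= r <= D)%N ->
  idem_entry h r != idem_entry h 0.
Proof.
move=> h0 rD; apply/eqP => sr.
have row_eq y z : dist e y z = r -> row (enum_rank y) (E h) = row (enum_rank z) (E h).
  move=> yz; set y' := enum_rank y; set z' := enum_rank z.
  have sqE u v : \sum_w E h u w * E h v w = idem_entry h (d u v).
    rewrite -idem_entryE -[in RHS](_ : E h *m (E h)^T = E h); last first.
      by rewrite (pi_sym HE) (pi_orth HE) eqxx.
    by rewrite mxE; apply: eq_bigr => w _; rewrite !mxE.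
  have S0 : \sum_w (E h y' w - E h z' w) ^+ 2 = 0.
    rewrite (eq_bigr (fun w => E h y' w * E h y' w + E h z' w * E h z' w
       - 2 * (E h y' w * E h z' w))); last by move=> w _; ring.
    rewrite sumrB big_split /= -mulr_sumr !sqE !enum_rankK yz sr !distxx; ring.
  have ge0 w : 0 <= (E h y' w - E h z' w) ^+ 2.
    by rewrite real_exprn_even_ge0 // rpredB ?(pi_real HE).
  apply/rowP => w; rewrite !mxE; apply/eqP; rewrite -subr_eq0 -sqrf_eq0.
  by apply/eqP/(psumr_eq0P (fun w _ => ge0 w) S0).
have row_all y z : row (enum_rank y) (E h) = row (enum_rank z) (E h).
  have /connectP[q qP ->] := Hprim rD y z.
  elim: q y qP => [|v q IH] y //= /andP[/eqP yv /IH <-]; exact: row_eq.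
have EhJ : E h = (idem_entry h 0 * #|T|%:R) *: E ord0.
  rewrite (pi_0 HE) scalerA -mulrA mulfV ?card_neq0 // mulr1.
  apply/matrixP => y z; rewrite !mxE mulr1.
  have /rowP/(_ z) := row_all (enum_val y) (enum_val z); rewrite !mxE !enum_valK => ->.
  by rewrite idem_entryE distxx.
have := idem_neq0 h; have /esym := pi_orth HE h h; rewrite {2}EhJ -scalemxAl (pi_orth HE) eqxx.
by rewrite eq_sym (negPf h0) scaler0 => ->; rewrite eqxx.
Qed.

Lemma idem_trace_neq0 l : \tr (E l) != 0.
Proof. by rewrite idem_trace mulf_neq0 ?card_neq0 ?idem_entry0_neq0. Qed.

(** * Krein parameters and dual distance matrices *)

Definition idem_coef (B : 'M[C]_#|T|) h := \tr (B *m E h) / \tr (E h).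

Lemma idem_coefE B : BM B -> B = \sum_h idem_coef B h *: E h.
Proof.
case/bose_mesnerP=> c cE; rewrite {1}cE; apply: eq_bigr => h _.
by rewrite /idem_coef cE idem_mull mxtraceZ mulfK ?idem_trace_neq0.
Qed.

(* |X| times [hadamard_coef i j l] is the Krein parameter q^l_ij. *)
Definition hadamard_coef i j l := idem_coef (map2_mx *%R (E i) (E j)) l.
Local Notation t := hadamard_coef.

Lemma hadamard_coefE i j : map2_mx *%R (E i) (E j) = \sum_l t i j l *: E l.
Proof.
apply: idem_coefE.
have -> : map2_mx *%R (E i) (E j) = fmx (fun h => idem_entry i h * idem_entry j h).
  by apply/matrixP => y z; rewrite !mxE !idem_entryE.
exact: (bose_mesner_of_distance_function He Hp x).
Qed.
Local Notation Ht := hadamard_coefE.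

Lemma hadamard_coefC i j l : t i j l = t j i l.
Proof.
apply: idem_coef_inj l; rewrite -!Ht; apply/matrixP => y z; rewrite !mxE; exact: mulrC.
Qed.

(** The right side is symmetric in [i], [j], [l], which is the source of the symmetry of vanishing
    Krein parameters. *)
Lemma hadamard_coef_trace i j l :
  t i j l * \tr (E l) = \sum_y \sum_z E i y z * E j y z * E l y z.
Proof.
have <- : \tr (map2_mx *%R (E i) (E j) *m E l) = t i j l * \tr (E l).
  by rewrite Ht idem_mull mxtraceZ.
apply: eq_bigr => y _; rewrite mxE; apply: eq_bigr => z _; rewrite mxE.
by rewrite -{1}(pi_sym HE l) mxE.
Qed.

Lemma hadamard_coef_eq0 i j l : (t i j l == 0) = (t i l j == 0).
Proof.
rewrite -(mulIr_eq0 _ (mulIf (idem_trace_neq0 l))).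
rewrite -[RHS](mulIr_eq0 _ (mulIf (idem_trace_neq0 j))).
rewrite !hadamard_coef_trace; congr (_ == 0).
by apply: eq_bigr => y _; apply: eq_bigr => z _; rewrite mulrAC.
Qed.

(** Coefficients of (E_i o E_j) o E_k = (E_i o E_k) o E_j. *)
Lemma hadamard_assoc i j k s : \sum_l t i j l * t l k s = \sum_l t i k l * t l j s.
Proof.
have prod i' j' k' : map2_mx *%R (map2_mx *%R (E i') (E j')) (E k') =
    \sum_s (\sum_l t i' j' l * t l k' s) *: E s.
  transitivity (\sum_l t i' j' l *: map2_mx *%R (E l) (E k')).
    apply/matrixP => y z; rewrite Ht !mxE !summxE mulr_suml.
    by apply: eq_bigr => l _; rewrite !mxE mulrA.
  rewrite (eq_bigr (fun l => \sum_s (t i' j' l * t l k' s) *: E s)).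
    by rewrite exchange_big; apply: eq_bigr => u _; rewrite scaler_suml.
  by move=> l _; rewrite Ht scaler_sumr; apply: eq_bigr => u _; rewrite scalerA.
apply: (@idem_coef_inj (fun s => \sum_l t i j l * t l k s)
  (fun s => \sum_l t i k l * t l j s)).
by rewrite -!prod; apply/matrixP => y z; rewrite !mxE mulrAC.
Qed.

Lemma hadamard_coef0 j l : t ord0 j l = (#|T|%:R)^-1 * (j == l)%:R.
Proof.
apply: (@idem_coef_inj _ (fun l => (#|T|%:R)^-1 * (j == l)%:R)).
rewrite -Ht (bigD1 j) //= big1 => [|i nij].
  by rewrite eqxx mulr1 addr0 (pi_0 HE); apply/matrixP => y z; rewrite !mxE mulr1.
by rewrite eq_sym (negPf nij) mulr0 scale0r.
Qed.

(* The products W r of the matrices E_h - s_j J (1 <= j <= r) under o, where s_j is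
   the entry of E_h at distance j, lie in the span of the E_v with v in S, and
   W D is a nonzero multiple of I because s_j <> s_0 for j > 0. *)
Lemma hadamard_connected h (S : {set 'I_D.+1}) : h != ord0 -> ord0 \in S ->
  (forall u v, u \in S -> t h u v != 0 -> v \in S) -> S = setT.
Proof.
move=> h0 S0 SP; pose s := idem_entry h.
pose W r := fmx (fun a => \prod_(1 <= j < r.+1) (s a - s j)).
have WS r v : v \notin S -> W r *m E v = 0.
  elim: r v => [|r IH] v vS.
    have -> : W 0%N = #|T|%:R *: E ord0.
      rewrite (pi_0 HE) scalerA mulfV ?card_neq0 // scale1r.
      by apply/matrixP => y z; rewrite !mxE big_geq.
    rewrite -scalemxAl (pi_orth HE) ifN ?scaler0 //.
    by apply: contraNneq vS => <-.
  have /bose_mesnerP[c Wc] := bose_mesner_of_distance_function He Hp x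
    (fun a => \prod_(1 <= j < r.+1) (s a - s j)).
  have c0 u : u \notin S -> c u = 0.
    move=> /IH; rewrite /W Wc idem_mull => /eqP.
    by rewrite scaler_eq0 (negPf (idem_neq0 u)) orbF => /eqP.
  (* Entrywise multiplication of [W r] by E_h - s_{r+1} J: the products E_h o E_i expand through
     [t h i l], and J is the unit. *)
  have -> : W r.+1 = \sum_l (\sum_i c i * t h i l) *: E l - s r.+1 *: W r.
    transitivity (\sum_i c i *: map2_mx *%R (E h) (E i) - s r.+1 *: W r).
      apply/matrixP => y z; rewrite !mxE big_nat_recr //= mulrBr.
      congr (_ - _); last by rewrite mulrC.
      have /matrixP/(_ y z) := Wc; rewrite !mxE => ->; rewrite !summxE mulr_suml.
      by apply: eq_bigr => i _; rewrite !mxE !idem_entryE -/s; ring.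
    congr (_ - _).
    rewrite (eq_bigr (fun i => \sum_l (c i * t h i l) *: E l)).
      by rewrite exchange_big; apply: eq_bigr => u _; rewrite scaler_suml.
    by move=> l _; rewrite Ht scaler_sumr; apply: eq_bigr => u _; rewrite scalerA.
  rewrite mulmxBl -scalemxAl IH // scaler0 subr0 idem_mull big1 ?scale0r // => i _.
  have [iS|/c0 ->] := boolP (i \in S); last by rewrite mul0r.
  have [->|nz] := eqVneq (t h i v) 0; first by rewrite mulr0.
  by rewrite (SP i v iS nz) in vS.
have WD : W D = (\prod_(1 <= j < D.+1) (s 0%N - s j)) *: 1%:M.
  rewrite -(distance_function1 C He); apply/matrixP => y z; rewrite !mxE.
  case: (d y z) (dist_le_diameter e (enum_val y) (enum_val z)) => [|a] aD.
    by rewrite mulr1.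
  rewrite mulr0 (bigD1_seq a.+1) ?iota_uniq ?mem_index_iota //=.
  by rewrite subrr mul0r.
apply/setP => v; rewrite inE; apply/negP => /negP vS.
have /eqP := WS D v vS; rewrite WD -scalemxAl mul1mx scaler_eq0 (negPf (idem_neq0 v)) orbF.
rewrite prodf_seq_eq0 => /hasP[j]; rewrite mem_index_iota /= subr_eq0 => jD.
by rewrite eq_sym (negPf (idem_entry_neq h0 jD)).
Qed.

(* |X| times [dual_mx h] is the dual distance matrix A*_h(x). *)
Definition dual_mx h : 'M[C]_#|T| := diag_mx (row (enum_rank x) (E h)).

(** Written out, the trace is the (x, x)-entry of E_h (E_i o E_j) E_k, and orthogonality leaves only
    the E_h-component of E_i o E_j. *)
Lemma dual_mx_trace i j k h :
  \tr (E i *m dual_mx k *m E j *m dual_mx h) = (h == k)%:R * t i j h * idem_entry h 0.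
Proof.
have -> : (h == k)%:R * t i j h * idem_entry h 0 =
    (E h *m (map2_mx *%R (E i) (E j)) *m E k) (enum_rank x) (enum_rank x).
  rewrite Ht idem_mulr -scalemxAl (pi_orth HE) mxE.
  by case: eqP => _; rewrite ?mxE ?idem_entryE ?distxx /= ?mul1r ?mul0r ?mulr0.
rewrite -(mulmxA (E h)) /mxtrace mxE; apply: eq_bigr => y _.
rewrite mul_mx_diag mxE mulrC !mxE; congr (_ * _).
apply: eq_bigr => z _; rewrite mul_mx_diag !mxE.
by rewrite -{1}(pi_sym HE j) -{1}(pi_sym HE k) !mxE mulrAC.
Qed.

(** The squared norm of the product is the trace in [dual_mx_trace] with [k = h], a multiple of
    [t i j h]. *)
Lemma dual_mx_eq0 i j h : t i j h = 0 -> E i *m dual_mx h *m E j = 0.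
Proof.
move=> tij; apply: mx_inner_eq0; rewrite /mx_inner !trmx_mul !map_mxM /=.
have dualC : map_mx Num.conj (dual_mx h) = dual_mx h.
  by rewrite map_diag_mx map_row idem_conj.
have -> : (dual_mx h)^T = dual_mx h by rewrite tr_diag_mx.
rewrite dualC !idem_conj !(pi_sym HE).
rewrite -!mulmxA (mulmxA (E i) (E i)) (pi_orth HE) eqxx mxtrace_mulC -!mulmxA.
by rewrite (pi_orth HE) eqxx mxtrace_mulC !mulmxA dual_mx_trace tij mulr0 mul0r.
Qed.

End Idempotents.

(** * Linear dependences between the 4D matrices *)

Section GramRelation.
Variables (C : numClosedFieldType) (T : finType) (e : rel T) (x : T).
Local Notation D := (diameter e).
Local Notation A := (dist_mx C e).
Local Notation Es := (dual_idem C e x).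

(* The four families are X B Y - Y B X with B = E*_i and (X, Y) equal to
   (A_2, A), (A_3, I), (A_2, I) and (A, I) respectively. *)
Definition left_factor (r : nat) := nth 0 [:: A 2; A 3; A 2; A 1] r.
Definition right_factor (r : nat) := nth 0 [:: A 1; 1%:M; 1%:M; 1%:M] r.
Local Notation X := left_factor.
Local Notation Y := right_factor.
Definition twisted_commutator r (B : 'M[C]_#|T|) := X r *m B *m Y r - Y r *m B *m X r.
Definition dual_function (b : nat -> C) : 'M[C]_#|T| :=
  diag_mx (\row_y b (dist e x (enum_val y))).

Lemma twisted_commutator_lin r a B B' :
  twisted_commutator r (a *: B + B') = a *: twisted_commutator r B + twisted_commutator r B'.
Proof.
rewrite /twisted_commutator !mulmxDr !mulmxDl -!scalemxAr -!scalemxAl scalerBr.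
by rewrite opprD addrACA.
Qed.

Lemma twisted_commutator_sum r (I : Type) (s : seq I) (P : pred I) c B :
  twisted_commutator r (\sum_(i <- s | P i) c i *: B i) =
  \sum_(i <- s | P i) c i *: twisted_commutator r (B i).
Proof.
elim/big_rec2: _ => [|i U V _ <-]; last exact: twisted_commutator_lin.
by rewrite /twisted_commutator mulmx0 mul0mx mulmx0 mul0mx subrr.
Qed.

(** The condition [b 0 = 0] matches the absence of E*_0 from the given family. *)
Lemma dual_function_sum b : b 0%N = 0 ->
  dual_function b = \sum_(0 <= i < D) b i.+1 *: Es i.+1.
Proof.
move=> b0; apply/matrixP => y z; rewrite big_mkord !mxE summxE.
under eq_bigr do rewrite !mxE.
have [->|_] := eqVneq y z; last by rewrite mulr0n big1 // => i _; rewrite mulr0.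
rewrite mulr1n; case E : (dist e x (enum_val z)) => [|h].
  by rewrite b0 big1 // => i _; rewrite mulr0.
have hD : (h < D)%N.
  rewrite -E; exact: leq_trans (leq_bigmax (enum_val z))
    (@leq_bigmax _ (fun x => \max_y dist e x y)%N x).
rewrite (bigD1 (Ordinal hD)) //= eqxx mulr1 big1 ?addr0 // => i /negPf ni.
by rewrite eqSS eq_sym (_ : (_ == _) = false) ?mulr0.
Qed.

Lemma nth_gram_family k : (k < 4 * D)%N ->
  (gram_family C e x)`_k = twisted_commutator (k %/ D) (Es (k %% D).+1).
Proof.
move=> lt_k; have D0 : (0 < D)%N by lia.
have lt_m := ltn_pmod k D0; have kE := divn_eq k D; have ltr : (k %/ D < 4)%N by rewrite ltn_divLR.
move: kE lt_m ltr; set i := (k %% D)%N; case: (k %/ D)%N => [|[|[|[|//]]]] -> lt_m _;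
  rewrite /twisted_commutator /left_factor /right_factor /= ?mulmx1 ?mul1mx /gram_family;
  rewrite !nth_cat !size_map !size_iota.
- by rewrite ifT ?(nth_map 0%N) ?size_iota ?nth_iota ?add1n //; lia.
- rewrite ifF; last by lia.
  by rewrite ifT ?(nth_map 0%N) ?size_iota ?nth_iota ?mul1n ?addKn ?add1n //; lia.
- rewrite ifF; last by lia.
  rewrite ifF; last by lia.
  rewrite ifT; last by lia.
  rewrite (_ : 2 * D + i - D - D = i)%N; last by lia.
  by rewrite ?(nth_map 0%N) ?size_iota ?nth_iota ?add1n.
- rewrite ifF; last by lia.
  rewrite ifF; last by lia.
  rewrite ifF; last by lia.
  rewrite (_ : 3 * D + i - D - D - D = i)%N; last by lia.
  by rewrite ?(nth_map 0%N) ?size_iota ?nth_iota ?add1n.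
Qed.

(** A coefficient vector of length 4D is cut into four blocks of length D, read as functions on the
    distances 1, ..., D. The normalisation [b r 0 = 0] rules out the trivial relations that come
    from scalar matrices. *)
Lemma gram_det0_relation : \det (gram C e x) = 0 <->
  exists b : nat -> nat -> C,
    [/\ forall r, b r 0%N = 0,
        exists r i, [/\ (r < 4)%N, (1 <= i <= D)%N & b r i != 0] &
        \sum_(0 <= r < 4) twisted_commutator r (dual_function (b r)) = 0].
Proof.
have comb (v : nat -> C) (b : nat -> nat -> C) :
    (forall r, b r 0%N = 0) ->
    (forall r i, (r < 4)%N -> (i < D)%N -> v (r * D + i)%N = b r i.+1) ->
    \sum_(k < 4 * D) v k *: (gram_family C e x)`_k =
    \sum_(0 <= r < 4) twisted_commutator r (dual_function (b r)).
  move=> b0 vb.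
  rewrite -(big_mkord xpredT (fun k => v k *: (gram_family C e x)`_k)) big_nat_mul.
  apply: eq_big_nat => r /andP[_ ltr].
  rewrite dual_function_sum // twisted_commutator_sum mulSn -{1}[(r * D)%N]add0n.
  rewrite big_addn addnK; apply: eq_big_nat => i /andP[_ lti].
  have D0 : (0 < D)%N by lia.
  have lt4 : (r * D + i < 4 * D)%N by nia.
  rewrite [(i + _)%N]addnC nth_gram_family // divnMDl // modnMDl.
  by rewrite divn_small // modn_small // addn0 vb.
split=> [/gram_det0P[u uF [k nzk]]|[b [b0 [r [i [ltr iD nz]]] bF]]].
  pose v k := if insub k is Some k' then u k' else 0.
  pose b r i := if i is i'.+1 then v (r * D + i')%N else 0.
  exists b; split=> //.
    have D0 : (0 < D)%N by have := ltn_ord k; lia.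
    exists (k %/ D)%N, (k %% D).+1; split; rewrite ?ltn_divLR ?ltn_ord //=.
      by rewrite ltn_pmod.
    by rewrite /v -divn_eq valK.
  rewrite -(comb v) // -[RHS]uF; apply: eq_bigr => k' _.
  by rewrite /v valK.
apply/gram_det0P; pose v k := b (k %/ D)%N (k %% D).+1.
have D0 : (0 < D)%N by lia.
have lt_k : (r * D + i.-1 < 4 * D)%N by nia.
exists (fun k : 'I__ => v k); last first.
  exists (Ordinal lt_k); rewrite /v /= divnMDl // modnMDl divn_small ?modn_small; try lia.
  by rewrite addn0 prednK //; lia.
rewrite (comb v b) // => r' i' ltr' lti'.
by rewrite /v divnMDl // modnMDl divn_small // modn_small // addn0.
Qed.

End GramRelation.

Lemma cubic_four_roots (K : fieldType) (f0 f1 f2 f3 : K) (rs : seq K) :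
  uniq rs -> size rs = 4%N ->
  {in rs, forall m, f0 + f1 * m + f2 * m ^+ 2 + f3 * m ^+ 3 = 0} -> f3 = 0.
Proof.
move=> urs srs roots; pose P := Poly [:: f0; f1; f2; f3].
have P0 : P = 0.
  apply/eqP; apply: contraT => nzP.
  have: (size rs < size P)%N.
    apply: max_poly_roots => //; apply/allP => m /roots mP; apply/eqP.
    by rewrite -[RHS]mP horner_Poly /=; ring.
  by rewrite srs ltnNge (size_Poly [:: f0; f1; f2; f3]).
by have := coef_Poly [:: f0; f1; f2; f3] 3; rewrite -/P P0 coef0.
Qed.

(** * Eigenvalues of the distance matrices and blocks of twisted commutators *)

Section Relation.
Variables (C : numClosedFieldType) (T : finType) (e : rel T).
Hypothesis He : connected_simple_graph e.
Variable p : nat -> nat -> nat -> nat.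
Local Notation D := (diameter e).
Hypothesis Hp : forall h i j, (h <= D)%N -> (i <= D)%N -> (j <= D)%N ->
  forall x y, dist e x y = h -> #|sphere e i x :&: sphere e j y| = p h i j.
Hypothesis Hprim : primitive e.
Hypothesis HD : (3 <= D)%N.
Variable x : T.
Local Notation A := (dist_mx C e).
Local Notation BM := (@bose_mesner C T e).
Local Notation d y z := (dist e (enum_val y) (enum_val z)).
Local Notation fmx := (@distance_function C T e).
Variable E : 'I_D.+1 -> 'M[C]_#|T|.
Hypothesis HE : primitive_idempotents E.
Local Notation t := (hadamard_coef E).
Local Notation X := (left_factor C e).
Local Notation Y := (right_factor C e).
Local Notation term := (@twisted_commutator C T e).
Local Notation dgm := (@dual_function C T e x).
Local Notation th := (idem_coef E (A 1)).

Let k : C := (p 0 1 1)%:R.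
Let a1 : C := (p 1 1 1)%:R.
Let c2 : C := (p 2 1 1)%:R.
Let b1 : C := (p 1 1 2)%:R.
Let a2 : C := (p 2 1 2)%:R.
Let c3 : C := (p 3 1 2)%:R.

Let c2_neq0 : c2 != 0.
Proof. by rewrite pnatr_eq0; case: (intersection_number_neq0 He Hp x (h := 1)) => //; lia. Qed.

Let c3_neq0 : c3 != 0.
Proof. by rewrite pnatr_eq0; case: (intersection_number_neq0 He Hp x (h := 2)) => //; lia. Qed.

Let k_neq0 : k != 0.
Proof. by rewrite pnatr_eq0; apply: (valency_neq0 He Hp x); lia. Qed.

(** [poly2] and [poly3] come from solving [dist_mx_square] for A_2 and [dist_mx_cube] for A_3. *)
Definition poly2 s : C := (s ^+ 2 - a1 * s - k) / c2.
Definition poly3 s : C := (s * poly2 s - b1 * s - a2 * poly2 s) / c3.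

Lemma dist_mx1_idem : A 1 = \sum_i th i *: E i.
Proof. by apply: (idem_coefE He Hp x HE); exact: BM_adj. Qed.

Lemma adj_mull i : A 1 *m E i = th i *: E i.
Proof. by rewrite [in LHS]dist_mx1_idem (idem_mull HE). Qed.

Lemma dist_mx2_mull i : A 2 *m E i = poly2 (th i) *: E i.
Proof.
have D2 : (2 <= D)%N by lia.
have := dist_mx_square C He Hp x D2; move/(congr1 (mulmx^~ (E i))).
rewrite -mulmxA adj_mull -scalemxAr adj_mull scalerA !mulmxDl -!scalemxAl mul1mx adj_mull.
rewrite scalerA -scalerDl -/k -/a1 -/c2 => /eqP; rewrite addrC -subr_eq => /eqP.
rewrite -scalerBl => E2; apply: (scalerI c2_neq0); rewrite scalerA -E2; congr (_ *: _).
by rewrite /poly2; field.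
Qed.

Lemma dist_mx3_mull i : A 3 *m E i = poly3 (th i) *: E i.
Proof.
have := dist_mx_cube C He Hp x HD; move/(congr1 (mulmx^~ (E i))).
rewrite -mulmxA dist_mx2_mull -scalemxAr adj_mull scalerA !mulmxDl -!scalemxAl adj_mull.
rewrite dist_mx2_mull !scalerA -scalerDl -/b1 -/a2 -/c3 => /eqP; rewrite addrC -subr_eq => /eqP.
rewrite -scalerBl => E2; apply: (scalerI c3_neq0); rewrite scalerA -E2; congr (_ *: _).
by rewrite /poly3; field.
Qed.

Definition left_eigen r s := nth 0 [:: poly2 s; poly3 s; poly2 s; s] r.
Definition right_eigen r s : C := nth 0 [:: s; 1; 1; 1] r.
Definition commutator_coef r s u :=
  left_eigen r s * right_eigen r u - right_eigen r s * left_eigen r u.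

Lemma mul_bose_mesner_comm B i s : BM B -> B *m E i = s *: E i -> E i *m B = s *: E i.
Proof.
move=> /(bose_mesnerP HE)[c ->]; rewrite (idem_mull HE) (idem_mulr HE) => /eqP.
by rewrite -subr_eq0 -scalerBl scaler_eq0 (negPf (idem_neq0 HE i)) orbF subr_eq0 => /eqP->.
Qed.

Lemma left_factor_bose_mesner r : BM (X r).
Proof.
case: r => [|[|[|[|r]]]]; rewrite /left_factor /= ?nth_nil; try exact: bose_mesner0.
- by apply: (bose_mesner_dist_mx C He Hp x); lia.
- exact: (bose_mesner_dist_mx C He Hp x).
- by apply: (bose_mesner_dist_mx C He Hp x); lia.
- exact: BM_adj.
Qed.

Lemma right_factor_bose_mesner r : BM (Y r).
Proof.
case: r => [|[|[|[|r]]]]; rewrite /right_factor /= ?nth_nil; try exact: bose_mesner0.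
- exact: BM_adj.
- exact: BM_one.
- exact: BM_one.
- exact: BM_one.
Qed.

Lemma left_factor_mull r i : X r *m E i = left_eigen r (th i) *: E i.
Proof.
case: r => [|[|[|[|r]]]]; rewrite /left_factor /left_eigen /= ?nth_nil.
- exact: dist_mx2_mull.
- exact: dist_mx3_mull.
- exact: dist_mx2_mull.
- exact: adj_mull.
- by rewrite mul0mx scale0r.
Qed.

Lemma right_factor_mull r i : Y r *m E i = right_eigen r (th i) *: E i.
Proof.
case: r => [|[|[|[|r]]]]; rewrite /right_factor /right_eigen /= ?nth_nil ?mul1mx ?scale1r //.
- exact: adj_mull.
- by rewrite mul0mx scale0r.
Qed.

(** Both factors lie in the Bose-Mesner algebra, so [E i] and [E j] absorb them as scalars. *)
Lemma twisted_commutator_block r B i j :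
  E i *m term r B *m E j = commutator_coef r (th i) (th j) *: (E i *m B *m E j).
Proof.
rewrite /twisted_commutator mulmxBr mulmxBl !mulmxA.
rewrite (mul_bose_mesner_comm (left_factor_bose_mesner r) (left_factor_mull r i)).
rewrite (mul_bose_mesner_comm (right_factor_bose_mesner r) (right_factor_mull r i)).
rewrite -!mulmxA left_factor_mull right_factor_mull -!scalemxAl -!scalemxAr !scalerA.
by rewrite -scalerBl.
Qed.

Lemma dual_mx_function h : dual_mx x E h = dgm (idem_entry x E h).
Proof.
congr diag_mx; apply/rowP => y; rewrite !mxE (idem_entryE He Hp x HE).
by rewrite enum_rankK.
Qed.

(** The diagonal of [dgm b] is row [x] of [fmx b], so the expansion of [fmx b] in the idempotents
    carries over. *)
Lemma dual_function_expand b :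
  dgm b = \sum_h idem_coef E (fmx b) h *: dual_mx x E h.
Proof.
apply/matrixP => y z; rewrite summxE !mxE.
have /matrixP/(_ (enum_rank x) y) := idem_coefE He Hp x HE
  (bose_mesner_of_distance_function He Hp x b).
rewrite summxE mxE enum_rankK; have [<-|nyz] := eqVneq y z.
  rewrite mulr1n => ->.
  by apply: eq_bigr => h _; rewrite !mxE eqxx mulr1n.
by move=> _; rewrite mulr0n big1 // => h _; rewrite !mxE (negPf nyz) mulr0n mulr0.
Qed.

Lemma commutator_function B (u : 'rV[C]_#|T|) y z :
  (B *m diag_mx u - diag_mx u *m B) y z = B y z * (u 0 z - u 0 y).
Proof. by rewrite mul_mx_diag mul_diag_mx !mxE; ring. Qed.

(** * From a Q-polynomial ordering to a dependence *)

Lemma relation_of_Q_polynomial : Q_polynomial_wrt E ->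
  exists b : nat -> nat -> C,
    [/\ forall r, b r 0%N = 0,
        exists r i, [/\ (r < 4)%N, (1 <= i <= D)%N & b r i != 0] &
        \sum_(0 <= r < 4) term r (dgm (b r)) = 0].
Proof.
case=> q krein qP; pose one : 'I_D.+1 := inord 1.
have oneE : one = 1%N :> nat by rewrite inordK //; lia.
have one_neq0 : one != ord0 by rewrite -val_eqE /= oneE.
pose s := idem_entry x E one; pose B := dual_mx x E one.
have t1 (i j : 'I_D.+1) : (1 + j < i)%N || (1 + i < j)%N -> E i *m B *m E j = 0.
  move=> lt; apply: (dual_mx_eq0 He Hp x HE).
  have -> : t i j one = (#|T|%:R)^-1 * q one i j.
    apply: (@idem_coef_inj _ _ _ _ HE _ (fun l => (#|T|%:R)^-1 * q l i j)).
    rewrite -(hadamard_coefE He Hp x HE) krein scaler_sumr.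
    by apply: eq_bigr => l _; rewrite scalerA.
  by rewrite (qP one i j).1 ?mulr0 // oneE lt orbT.
(* y telescopes so that y i - y j is the coefficient of the (i, j) block for |i - j| = 1. *)
pose y i := - \sum_(0 <= l < i) commutator_coef 0 (th (inord l)) (th (inord l.+1)).
have yS (i j : 'I_D.+1) : j = i.+1 :> nat -> y i - y j = commutator_coef 0 (th i) (th j).
  move=> ji; rewrite /y ji big_nat_recr //= opprK addKr.
  by rewrite -ji !inord_val.
pose V := \sum_(i < D.+1) y i *: E i.
(* Comparison of (i, j)-blocks. Those with |i - j| > 1 vanish on both sides, and antisymmetry of
   [commutator_coef] reduces the others to [yS] or to [i = j]. *)
have BV : term 0 B = V *m B - B *m V.
  apply/eqP; rewrite -subr_eq0; apply/eqP/(idem_eq HE) => i j.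
  rewrite mulmxBr mulmxBl twisted_commutator_block mulmxBr mulmxBl !mulmxA.
  rewrite /V (idem_mulr HE) -[E i *m B *m _ *m E j]mulmxA (idem_mull HE).
  rewrite -!scalemxAl -scalemxAr -!scalerBl.
  have [lt|ge] := boolP ((1 + j < i)%N || (1 + i < j)%N).
    by rewrite t1 // scaler0.
  suff -> : commutator_coef 0 (th i) (th j) = y i - y j by rewrite subrr scale0r.
  have [/yS //|nij] := eqVneq (j : nat) i.+1.
  have [/yS yji|nji] := eqVneq (i : nat) j.+1.
    by rewrite -opprB yji /commutator_coef opprB [X in _ - X]mulrC [X in X - _]mulrC.
  have -> : i = j by apply: val_inj => /=; lia.
  by rewrite /commutator_coef subrr [left_eigen _ _ * _]mulrC subrr.
have [v vE] : exists v, V = fmx v.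
  by apply: (bose_mesner_distance_function He Hp); apply/(bose_mesnerP HE); exists y.
(* The dependence to be shown is [term 0 B] = v_3 [A_3, B] + v_2 [A_2, B] + v_1 [A, B], listed in
   the order of [left_factor]. Subtracting [s 0] gives [b r 0 = 0] and changes each matrix only by a
   scalar one. *)
pose b r i := nth 0 [:: 1; - v 3%N; - v 2%N; - v 1%N] r * (s i - s 0%N).
exists b; split=> [r||]; first by rewrite /b subrr mulr0.
  exists 0%N, 1%N; split=> //; first by lia.
  rewrite /b mul1r subr_eq0 (idem_entry_neq He Hp x HE Hprim) //; lia.
have dgmE r : dgm (b r) = nth 0 [:: 1; - v 3%N; - v 2%N; - v 1%N] r *: (- s 0%N *: 1%:M + B).
  rewrite /B dual_mx_function -/s; apply/matrixP => y' z; rewrite !mxE.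
  by case: (y' == z); rewrite /b ?mulr1n ?mulr0n; ring.
have term1 r : term r 1%:M = 0.
  apply: (idem_eq HE) => i j; rewrite twisted_commutator_block mulmx1 (pi_orth HE).
  case: eqP => [->|_]; last by rewrite scaler0.
  by rewrite /commutator_coef mulrC subrr scale0r.
have termE r : term r (dgm (b r)) = nth 0 [:: 1; - v 3%N; - v 2%N; - v 1%N] r *: term r B.
  rewrite dgmE -[_ *: _ in LHS]addr0 twisted_commutator_lin twisted_commutator_lin term1.
  by rewrite scaler0 add0r /twisted_commutator mulmx0 mul0mx mulmx0 mul0mx subrr addr0.
rewrite (eq_bigr _ (fun r _ => termE r)) !big_nat_recl // big_geq // addr0 /= scale1r.
(* A nonzero entry of [term 0 B] needs a walk made of steps of lengths 1 and 2, so the values of [v]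
   beyond distance 3 contribute nothing to [V, B]. *)
have far y' z : (3 < d y' z)%N -> term 0 B y' z = 0.
  move=> far; rewrite /twisted_commutator /left_factor /right_factor /= /B.
  rewrite dual_mx_function /dual_function !mul_mx_diag !mxE !big1 ?subrr // => w _; rewrite !mxE.
    have [d1|] := eqVneq (d w z) 2%N; last by rewrite mulr0.
    have [d2|] := eqVneq (d y' w) 1%N; last by rewrite !mul0r.
    by have := dist_triangle He (enum_val w) (enum_val y') (enum_val z); lia.
  have [d1|] := eqVneq (d w z) 1%N; last by rewrite mulr0.
  have [d2|] := eqVneq (d y' w) 2%N; last by rewrite !mul0r.
  by have := dist_triangle He (enum_val w) (enum_val y') (enum_val z); lia.
apply/matrixP => y' z; have := far y' z; rewrite BV vE.
rewrite /twisted_commutator /left_factor /right_factor /= !mulmx1 !mul1mx.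
have entry M : (M *m B - B *m M) y' z =
    M y' z * (s (dist e x (enum_val z)) - s (dist e x (enum_val y'))).
  by rewrite /B dual_mx_function commutator_function !mxE.
have addE (M M' : 'M[C]_#|T|) : (M + M') y' z = M y' z + M' y' z by rewrite mxE.
have scaleE a (M : 'M[C]_#|T|) : (a *: M) y' z = a * M y' z by rewrite mxE.
rewrite entry addE entry !addE !scaleE !entry !mxE.
case E0 : (d y' z) => [|[|[|[|m]]]] /= H.
- have /eqP := E0; rewrite (dist_eq0 He) => /eqP/enum_val_inj->; rewrite subrr; ring.
- ring.
- ring.
- ring.
- rewrite H //; ring.
Qed.

(** * From a dependence to a Q-polynomial ordering *)

Section FromRelation.
Variable b : nat -> nat -> C.
Hypothesis b_rel : \sum_(0 <= r < 4) term r (dgm (b r)) = 0.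
Local Notation c r h := (idem_coef E (fmx (b r)) h).

(** Taking the trace of the (i, j)-block against A*_h isolates the index [h], by [dual_mx_trace]. *)
Lemma relation_eigenvalues i j h : t i j h != 0 ->
  \sum_(0 <= r < 4) c r h * commutator_coef r (th i) (th j) = 0.
Proof.
move=> tij; have /(congr1 (fun M => \tr (E i *m M *m E j *m dual_mx x E h))) := b_rel.
rewrite mulmx0 !mul0mx mxtrace0 mulmx_sumr !mulmx_suml raddf_sum /=.
have nz : t i j h * idem_entry x E h 0 != 0.
  by rewrite mulf_neq0 // (idem_entry0_neq0 He Hp x HE).
move=> S0; apply: (mulIf nz); rewrite mul0r -[RHS]S0 mulr_suml; apply: eq_bigr => r _.
rewrite twisted_commutator_block -scalemxAl mxtraceZ dual_function_expand.
rewrite mulmx_sumr !mulmx_suml raddf_sum /= (bigD1 h) //= big1 => [|l nlh].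
  rewrite -scalemxAr -!scalemxAl mxtraceZ (dual_mx_trace He Hp x HE) eqxx mul1r addr0; ring.
rewrite -scalemxAr -!scalemxAl mxtraceZ (dual_mx_trace He Hp x HE).
by rewrite eq_sym (negPf nlh) !mul0r mulr0.
Qed.

(** The relation splits into one for each [h]: every (i, j)-block is zero, either because E_i A*_h
    E_j is or by [relation_eigenvalues]. *)
Lemma relation_dual_mx h :
  \sum_(0 <= r < 4) c r h *: term r (dual_mx x E h) = 0.
Proof.
apply: (idem_eq HE) => i j; rewrite mulmx_sumr mulmx_suml.
have [t0|tnz] := eqVneq (t i j h) 0.
  rewrite big1 // => r _; rewrite -scalemxAr -scalemxAl twisted_commutator_block.
  by rewrite (dual_mx_eq0 He Hp x HE t0) !scaler0.
under eq_bigr do rewrite -scalemxAr -scalemxAl twisted_commutator_block scalerA.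
by rewrite -scaler_suml relation_eigenvalues // scale0r.
Qed.

(** This is the entry of [relation_dual_mx] at (x, z) with z at distance [m] from x: A_2 A*_h A
    contributes s_2 p^m_21 and A A*_h A_2 contributes s_1 p^m_12. *)
Lemma relation_entry h m : (1 <= m <= 3)%N ->
  let s := idem_entry x E h in
  c 0%N h * (p m 1 2)%:R * (s 2%N - s 1%N) +
  (c 1%N h * (m == 3%N)%:R + c 2%N h * (m == 2%N)%:R + c 3%N h * (m == 1%N)%:R)
    * (s m - s 0%N) = 0.
Proof.
move=> m13 s; have mD : (m <= D)%N by lia.
have [z xz] := sphere_neq0 He Hp x mD.
have /matrixP/(_ (enum_rank x) (enum_rank z)) := relation_dual_mx h.
rewrite dual_mx_function -/s !big_nat_recl // big_geq // addr0.
rewrite /twisted_commutator /left_factor /right_factor /= !mulmx1 !mul1mx /dual_function.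
rewrite !mul_mx_diag !mul_diag_mx !mxE !enum_rankK xz distxx.
have entry i j : (i <= D)%N -> (j <= D)%N ->
    \sum_w (\matrix_(y, v) (A i y v * (\row_u s (dist e x (enum_val u))) 0 v))
      (enum_rank x) w * A j w (enum_rank z) = s i * (p m i j)%:R.
  move=> iD jD; rewrite -xz -[in dist e x z](enum_rankK x) -[in dist _ _ z](enum_rankK z).
  rewrite -(sum_dist_eq C He Hp) // mulr_sumr; apply: eq_bigr => w _.
  rewrite !mxE enum_rankK.
  by case: eqP => [->|_]; rewrite ?mul1r // !mul0r mulr0.
rewrite !entry; try lia.
rewrite (intersection_numberC He Hp x (i := 2)) //; try lia.
by move=> H; rewrite -[RHS]H; ring.
Qed.

Hypothesis b0 : forall r, b r 0%N = 0.
Hypothesis b_neq0 : exists r i, [/\ (r < 4)%N, (1 <= i <= D)%N & b r i != 0].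

(** Otherwise every [fmx (b r)] with [r < 4] would be a multiple of J, so [b r] would be constant on
    0, ..., D, hence zero there because [b r 0 = 0]. *)
Lemma relation_nontrivial :
  exists2 h, h != ord0 & exists2 r, (r < 4)%N & c r h != 0.
Proof.
case: (pickP (fun hr : 'I_D.+1 * 'I_4 => (hr.1 != ord0) && (c hr.2 hr.1 != 0))).
  by move=> [h r] /= /andP[h0 nz]; exists h => //; exists r.
move=> c0; have [r [i [ltr /andP[_ iD]]]] := b_neq0; case/eqP.
have := idem_coefE He Hp x HE (bose_mesner_of_distance_function He Hp x (b r)).
rewrite (bigD1 ord0) //= big1 ?addr0 => [|h h0]; last first.
  by have /negbT := c0 (h, Ordinal ltr); rewrite /= h0 negbK => /eqP ->; rewrite scale0r.
rewrite (pi_0 HE) scalerA; set q := _ * _ => bE.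
have {bE} /(distance_function_inj He Hp x) qE : fmx (b r) = fmx (fun=> q).
  by rewrite bE; apply/matrixP => y z; rewrite !mxE mulr1.
by rewrite qE // -(qE 0%N) // b0.
Qed.

Section FixedIndex.
Variable h : 'I_D.+1.
Hypothesis h_neq0 : h != ord0.
Hypothesis ch_neq0 : exists2 r, (r < 4)%N & c r h != 0.

Lemma hadamard_coef_0h v : (t ord0 v h != 0) = (v == h).
Proof.
rewrite (hadamard_coef0 He Hp x HE) mulf_eq0 invr_eq0 (negPf (card_neq0 C x)) /=.
by rewrite pnatr_eq0; case: (v == h).
Qed.

(** If [c 1 h] is zero, the entries at distances 3, 2, 1 leave only [c 0 h] nonzero, and adjacent
    indices i, j satisfy th_i th_j = -k. Then 0 is the only neighbour of [h] other than [h] itself,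
    so {0, h} is closed under adjacency and connectedness gives D = 1. *)
Lemma dist_mx3_coef_neq0 : c 1%N h != 0.
Proof.
apply/eqP => c1; have [r ltr nz] := ch_neq0; set s := idem_entry x E h.
have s_neq m : (1 <= m <= D)%N -> s m - s 0%N != 0.
  by move=> mD; rewrite subr_eq0; apply: (idem_entry_neq He Hp x HE Hprim h_neq0 mD).
have c0s : c 0%N h * (s 2%N - s 1%N) = 0.
  have /eqP := relation_entry h (m := 3) isT; rewrite -/s c1 !mul0r !add0r !mulr0 !addr0 mul0r addr0.
  by rewrite mulrAC mulf_eq0 (negPf c3_neq0) orbF => /eqP.
have c2h : c 2%N h = 0.
  have /eqP := relation_entry h (m := 2) isT; rewrite -/s c1 !mul0r !add0r !mulr0 !addr0 mulr1.
  by rewrite mulrAC c0s mul0r add0r mulf_eq0 (negPf (s_neq 2%N _)) ?orbF => [/eqP//|]; lia.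
have c3h : c 3%N h = 0.
  have /eqP := relation_entry h (m := 1) isT; rewrite -/s c1 !mul0r !add0r !mulr0 !add0r mulr1.
  by rewrite mulrAC c0s mul0r add0r mulf_eq0 (negPf (s_neq 1%N _)) ?orbF => [/eqP//|]; lia.
have c0h : c 0%N h != 0.
  by move: r ltr nz => [|[|[|[|//]]]] _; rewrite ?c1 ?c2h ?c3h ?eqxx.
have prod_eq i j : i != j -> t i j h != 0 -> th i * th j = - k.
  move=> nij /relation_eigenvalues/eqP.
  rewrite !big_nat_recl // big_geq // c1 c2h c3h !mul0r !addr0 mulf_eq0 (negPf c0h) /=.
  rewrite /commutator_coef /left_eigen /right_eigen /=.
  (* The factor th_i - th_j is nonzero since distinct idempotents have distinct eigenvalues. *)
  have -> : poly2 (th i) * th j - th i * poly2 (th j) =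
      (th i - th j) * (th i * th j + k) / c2.
    by rewrite /poly2; field.
  rewrite !mulf_eq0 invr_eq0 (negPf c2_neq0) orbF subr_eq0.
  by rewrite (inj_eq (eigenvalue_inj HE dist_mx1_idem)) (negPf nij) addr_eq0 => /eqP.
have th0h : th ord0 * th h = - k by apply: prod_eq; rewrite ?hadamard_coef_0h // eq_sym.
have thh : th h != 0.
  by apply/eqP => th0; move/eqP: th0h; rewrite th0 mulr0 eq_sym oppr_eq0 (negPf k_neq0).
have S0 : ord0 \in [set ord0; h] by rewrite !inE eqxx.
have : #|[set ord0; h]| = D.+1; last by rewrite cards2 eq_sym h_neq0 => -[DE]; lia.
rewrite (hadamard_connected He Hp x HE Hprim h_neq0 S0) ?cardsT ?card_ord // => u v.
rewrite !inE => /orP[] /eqP ->.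
  rewrite (hadamard_coefC He Hp x HE) (hadamard_coef_eq0 He Hp x HE) hadamard_coef_0h.
  by move=> ->; rewrite orbT.
have [-> _|nvh tv] := eqVneq v h; first by rewrite orbT.
rewrite orbF; apply/eqP/(eigenvalue_inj HE dist_mx1_idem)/(mulfI thh).
rewrite [RHS]mulrC th0h; apply: prod_eq; first by rewrite eq_sym.
by rewrite (hadamard_coef_eq0 He Hp x HE).
Qed.

Definition dual_adjacent : rel 'I_D.+1 := [rel u v | (u != v) && (t u v h != 0)].

(** For fixed [u] the eigenvalues of its neighbours are roots of one cubic, whose leading
    coefficient is a nonzero multiple of [c 1 h]. *)
Lemma dual_adjacent_degree u v1 v2 v3 :
  dual_adjacent u v1 -> dual_adjacent u v2 -> dual_adjacent u v3 ->
  ~~ uniq [:: v1; v2; v3].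
Proof.
move=> /andP[n1 t1] /andP[n2 t2] /andP[n3 t3]; apply/negP => uv.
set s := th u.
(* The coefficients of m^3, m^2, m and 1 in the relation for the eigenvalues [s] and [m], once
   [poly2 m] and [poly3 m] are expanded. *)
pose f3 := - c 1%N h / (c2 * c3).
pose f2 := - c 0%N h * s / c2 + c 1%N h * (a1 + a2) / (c2 * c3) - c 2%N h / c2.
pose f1 := c 0%N h * (poly2 s + s * a1 / c2)
  + c 1%N h * (k + c2 * b1 - a2 * a1) / (c2 * c3) + c 2%N h * a1 / c2 - c 3%N h.
pose f0 := c 0%N h * s * k / c2 + c 1%N h * (poly3 s - a2 * k / (c2 * c3))
  + c 2%N h * (poly2 s + k / c2) + c 3%N h * s.
have FE m : f0 + f1 * m + f2 * m ^+ 2 + f3 * m ^+ 3 =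
    \sum_(0 <= r < 4) c r h * commutator_coef r s m.
  rewrite !big_nat_recl // big_geq // addr0 /commutator_coef /left_eigen /right_eigen /=.
  rewrite /f0 /f1 /f2 /f3; set P3 := poly3 s; set P2 := poly2 s.
  by rewrite /poly3 /poly2; field; rewrite c2_neq0 c3_neq0.
have inj_th := eigenvalue_inj HE dist_mx1_idem.
(* As a polynomial in m, this has the root s besides th v1, th v2, th v3. *)
have : f3 = 0.
  apply: (@cubic_four_roots _ f0 f1 f2 f3 [seq th v | v <- [:: u; v1; v2; v3]]) => //.
    rewrite (map_inj_uniq inj_th) cons_uniq uv andbT !inE !negb_or n1 n2 n3 //.
  move=> m /mapP[v + ->]; rewrite FE !inE => /or4P[] /eqP ->.
  - by rewrite big1 // => r _; rewrite /commutator_coef -/s [left_eigen _ _ * _]mulrC subrr mulr0.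
  - exact: relation_eigenvalues.
  - exact: relation_eigenvalues.
  - exact: relation_eigenvalues.
move/eqP; rewrite mulf_eq0 oppr_eq0 invr_eq0 (mulf_eq0 c2).
by rewrite (negPf dist_mx3_coef_neq0) (negPf c2_neq0) (negPf c3_neq0).
Qed.

Lemma Q_polynomial_of_relation_at : Q_polynomial C e.
Proof.
have asym : symmetric dual_adjacent.
  by move=> u v; rewrite /dual_adjacent /=; rewrite eq_sym (hadamard_coefC He Hp x HE).
have airr : irreflexive dual_adjacent by move=> u; rewrite /dual_adjacent /= eqxx.
have nb0 v : dual_adjacent ord0 v -> v = h.
  by case/andP=> _; rewrite hadamard_coef_0h => /eqP.
have nb00 v1 v2 : dual_adjacent ord0 v1 -> dual_adjacent ord0 v2 -> v1 = v2.
  by move=> /nb0 -> /nb0 ->.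
have conn (S : {set 'I_D.+1}) : ord0 \in S ->
    (forall u v, u \in S -> dual_adjacent u v -> v \in S) -> S = setT.
  move=> S0 SP; apply: (hadamard_connected He Hp x HE Hprim h_neq0 S0) => u v uS.
  rewrite (hadamard_coefC He Hp x HE) (hadamard_coef_eq0 He Hp x HE) => tuv.
  by have [<-//|nuv] := eqVneq u v; apply: SP uS _; rewrite /dual_adjacent /= nuv.
have [s s0 sE] := path_ordering asym airr conn dual_adjacent_degree nb00.
have HEs := primitive_idempotents_perm s0 HE.
(* The second vertex of the path is a neighbour of 0, hence [h]; so E_h acts tridiagonally in the
   new order. *)
have s1 : s (inord 1) = h.
  apply: nb0; rewrite -s0 sE inordK //; lia.
exists (E \o s) => //; exists (fun l i j => #|T|%:R * t (s i) (s j) (s l)) => [i j|l i j].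
  rewrite /= (hadamard_coefE He Hp x HE) scaler_sumr (reindex_perm s).
  apply: eq_bigr => l _; rewrite scalerA mulrA mulVf ?mul1r //; exact: card_neq0.
pose q i j l := t (s i) (s j) (s l).
have [] := @tridiagonal_structure_constants _ D _ q _ _ _ _ _ l i j.
- by lia.
- by move=> i' j' l'; rewrite /q (hadamard_coefC He Hp x HE).
- by move=> i' j' l'; rewrite /q (hadamard_coef_eq0 He Hp x HE).
- move=> i' j' k' l'; rewrite /q.
  have := hadamard_assoc He Hp x HE (s i') (s j') (s k') (s l').
  by rewrite (reindex_perm s) [RHS](reindex_perm s).
- move=> j' l'; rewrite /q s0 (hadamard_coef0 He Hp x HE) mulf_eq0 invr_eq0.
  rewrite (negPf (card_neq0 C x)) /=.
  by rewrite (inj_eq perm_inj); rewrite pnatr_eq0; case: (j' == l').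
- move=> i' l' nil; rewrite /q s1 -sE /dual_adjacent /= (inj_eq perm_inj) nil /=.
  by rewrite (hadamard_coefC He Hp x HE) (hadamard_coef_eq0 He Hp x HE).
move=> q0 q1; split=> H; first by rewrite [t _ _ _]q0 ?mulr0.
by rewrite mulf_neq0 ?q1 //; apply: card_neq0.
Qed.

End FixedIndex.

Lemma Q_polynomial_of_relation : Q_polynomial C e.
Proof. by have [h h0 cn] := relation_nontrivial; apply: (Q_polynomial_of_relation_at h0 cn). Qed.

End FromRelation.
End Relation.

(** * Functional calculus of a normal matrix *)

Section SpectralCalculus.
Variables (C : numClosedFieldType) (n : nat) (A : 'M[C]_n).
Let P := spectralmx A.
Let sp := spectral_diag A.

Definition spectral_fun (f : C -> C) : 'M[C]_n :=
  invmx P *m diag_mx (\row_i f (sp 0 i)) *m P.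
Local Notation F := spectral_fun.

Let Pu : P \in unitmx := spectral_unit A.

Lemma spectral_fun_mul f g : F f *m F g = F (fun s => f s * g s).
Proof.
rewrite /F !mulmxA mulmxK // -[_ *m diag_mx _ *m diag_mx _]mulmxA mulmx_diag.
by congr (_ *m diag_mx _ *m _); apply/rowP => i; rewrite !mxE.
Qed.

Lemma spectral_fun_lin a f g : a *: F f + F g = F (fun s => a * f s + g s).
Proof.
rewrite /F scalemxAl scalemxAr -mulmxDl -mulmxDr; congr (_ *m _ *m _).
by apply/matrixP => i j; rewrite !mxE; case: (i == j); rewrite ?mulr1n ?mulr0n ?mulr0 ?addr0.
Qed.

Lemma spectral_funZ a f : a *: F f = F (fun s => a * f s).
Proof.
rewrite /F scalemxAl scalemxAr; congr (_ *m _ *m _).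
by apply/matrixP => i j; rewrite !mxE; case: (i == j); rewrite ?mulr1n ?mulr0n ?mulr0.
Qed.

Lemma spectral_fun_sum (I : Type) (r : seq I) (c : I -> C) (f : I -> C -> C) :
  \sum_(i <- r) c i *: F (f i) = F (fun s => \sum_(i <- r) c i * f i s).
Proof.
elim: r => [|i r IH].
  rewrite big_nil /F [X in diag_mx X](_ : _ = 0) ?raddf0 ?mulmx0 ?mul0mx //.
  by apply/rowP => j; rewrite !mxE big_nil.
rewrite big_cons IH spectral_fun_lin /F; congr (_ *m diag_mx _ *m _).
by apply/rowP => j; rewrite !mxE big_cons.
Qed.

Lemma spectral_fun1 : F (fun=> 1) = 1%:M.
Proof.
rewrite /F (_ : diag_mx _ = 1%:M) ?mulmx1 ?mulVmx //.
by apply/matrixP => i j; rewrite !mxE.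
Qed.

Lemma spectral_fun_eq f g : F f = F g <-> forall i, f (sp 0 i) = g (sp 0 i).
Proof.
split=> [fg i|fg]; last by congr (_ *m diag_mx _ *m _); apply/rowP => i; rewrite !mxE.
have : P *m F f *m invmx P = P *m F g *m invmx P by rewrite fg.
rewrite /F !mulmxA !mulmxV // !mul1mx -!mulmxA !mulmxV // !mulmx1.
by move=> /matrixP/(_ i i); rewrite !mxE eqxx !mulr1n.
Qed.

Lemma spectral_fun_id : A \is normalmx -> F id = A.
Proof.
move=> /orthomx_spectralP AE; rewrite [RHS]AE /F; congr (_ *m diag_mx _ *m _).
by apply/rowP => i; rewrite !mxE.
Qed.

(** A real function of the spectrum gives a Hermitean matrix, since the diagonalising matrix is
    unitary. *)
Lemma spectral_fun_conj f : (forall s, (f s)^* = f s) ->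
  map_mx Num.conj (F f) = (F f)^T.
Proof.
move=> fR; rewrite /F !trmx_mul !map_mxM /= map_diag_mx tr_diag_mx mulmxA.
rewrite (invmx_unitary (spectral_unitarymx A)) -/P.
have -> : map_mx Num.conj (\row_i f (sp 0 i)) = \row_i f (sp 0 i).
  by apply/rowP => i; rewrite !mxE fR.
by congr (_ *m _ *m _); apply/matrixP => i j; rewrite !mxE ?conjCK.
Qed.

End SpectralCalculus.

(** * Existence of the primitive idempotents *)

Section Existence.
Variables (C : numClosedFieldType) (T : finType) (e : rel T).
Hypothesis He : connected_simple_graph e.
Variable p : nat -> nat -> nat -> nat.
Local Notation D := (diameter e).
Hypothesis Hp : forall h i j, (h <= D)%N -> (i <= D)%N -> (j <= D)%N ->
  forall x y, dist e x y = h -> #|sphere e i x :&: sphere e j y| = p h i j.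
Hypothesis HD : (1 <= D)%N.
Variable x : T.
Local Notation A := (dist_mx C e).
Local Notation BM := (@bose_mesner C T e).
Local Notation d y z := (dist e (enum_val y) (enum_val z)).
Local Notation fmx := (@distance_function C T e).
Local Notation F := (spectral_fun (A 1)).
Local Notation sp := (spectral_diag (A 1)).
Local Notation N := (#|T|%:R : C).

Let adj_normal : A 1 \is normalmx.
Proof.
apply/normalmxP; congr (_ *m _); apply/matrixP => y z.
  by rewrite !mxE (dist_sym He) conjC_nat.
by rewrite !mxE (dist_sym He) conjC_nat.
Qed.

Let spectrum := [seq sp 0 i | i <- enum 'I_#|T|].

Lemma spectral_fun_in f g : {in spectrum, f =1 g} -> F f = F g.
Proof. by move=> fg; apply/spectral_fun_eq => i; apply/fg/map_f/mem_enum. Qed.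

Lemma bose_mesner_spectral B : BM B -> exists f, B = F f.
Proof.
elim=> [||a R S _ [f ->] _ [g ->]|R S _ [f ->] _ [g ->]].
- by exists (fun=> 1); rewrite spectral_fun1.
- by exists id; rewrite spectral_fun_id.
- by eexists; apply: spectral_fun_lin.
- by eexists; apply: spectral_fun_mul.
Qed.

Lemma lagrange_bose_mesner (l : seq C) : BM (F (fun s => \prod_(m <- l) (s - m))).
Proof.
elim: l => [|m l IH].
  rewrite (_ : F _ = 1%:M); first exact: BM_one.
  by rewrite -(spectral_fun1 (A 1)); apply/spectral_fun_eq => i; rewrite big_nil.
have -> : F (fun s => \prod_(m' <- m :: l) (s - m')) =
    (- m *: 1%:M + A 1) *m F (fun s => \prod_(m <- l) (s - m)).
  rewrite -(spectral_fun1 (A 1)) -[X in _ + X](spectral_fun_id adj_normal).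
  rewrite spectral_fun_lin spectral_fun_mul; apply/spectral_fun_eq => i.
  by rewrite big_cons; ring.
by apply: BM_mul => //; apply: BM_lin; [exact: BM_one|exact: BM_adj].
Qed.

(** Lagrange interpolation: on the spectrum the indicator of [v] is a polynomial. *)
Lemma spectral_delta_bose_mesner v : BM (F (fun s => (s == v)%:R)).
Proof.
pose l := rem v (undup spectrum).
have nz : \prod_(m <- l) (v - m) != 0.
  rewrite prodf_seq_neq0; apply/allP => m; rewrite /l (rem_filter _ (undup_uniq _)) mem_filter /=.
  by rewrite subr_eq0 eq_sym => /andP[].
have -> : F (fun s => (s == v)%:R) =
    (\prod_(m <- l) (v - m))^-1 *: F (fun s => \prod_(m <- l) (s - m)).
  rewrite spectral_funZ; apply: spectral_fun_in => s ss /=.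
  have [->|nsv] := eqVneq s v; first by rewrite mulVf.
  have sl : s \in l by rewrite /l (rem_filter _ (undup_uniq _)) mem_filter /= nsv mem_undup.
  by rewrite [X in _ * X](bigD1_seq s) ?rem_uniq ?undup_uniq //= subrr mul0r mulr0.
by apply/bose_mesnerZ/lagrange_bose_mesner.
Qed.

Let k : C := (p 0 1 1)%:R.

(** J is some f(A), and AJ = kJ confines f to the eigenvalue [k]; then J^2 = |X| J forces f(k) =
    |X|. *)
Lemma spectral_all_ones :
  k \in spectrum /\ F (fun s => (s == k)%:R) = N^-1 *: const_mx 1.
Proof.
pose J : 'M[C]_#|T| := const_mx 1.
have N0 : N != 0 := card_neq0 C x.
have BJ : BM J.
  rewrite (_ : J = fmx (fun=> 1)); last by apply/matrixP => y z; rewrite !mxE.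
  exact: (bose_mesner_of_distance_function He Hp x).
have [f JE] := bose_mesner_spectral BJ.
have AJ : A 1 *m J = k *: J.
  apply/matrixP => y z; rewrite !mxE mulr1.
  have := sum_dist_eq C He Hp y y HD HD; rewrite distxx -/k => <-; apply: eq_bigr => w _.
  by rewrite !mxE mulr1 (dist_sym He (enum_val w)) -natrM mulnb andbb.
have fE i : f (sp 0 i) != 0 -> sp 0 i = k.
  have /spectral_fun_eq/(_ i) : F (fun s => s * f s) = F (fun s => k * f s).
    rewrite -spectral_fun_mul spectral_fun_id // -JE AJ JE.
    by rewrite spectral_funZ.
  by move=> /= /eqP fi nz; move: fi; rewrite (inj_eq (mulIf nz)) => /eqP.
have [i nzi] : exists i, f (sp 0 i) != 0.
  apply/existsP; apply: contraT; rewrite negb_exists => /forallP f0.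
  have : J (enum_rank x) (enum_rank x) = 0; last by rewrite mxE => /eqP; rewrite oner_eq0.
  have F0 : F f = 0 *: F f.
    rewrite spectral_funZ; apply/spectral_fun_eq => i.
    by rewrite mul0r; apply/eqP/negbNE.
  by rewrite JE F0 scale0r mxE.
have kE := fE i nzi; split; first by rewrite -kE map_f ?mem_enum.
have Jk : J = f k *: F (fun s => (s == k)%:R).
  rewrite JE spectral_funZ; apply/spectral_fun_eq => j.
  have [->|nk] := eqVneq (sp 0 j) k; first by rewrite mulr1.
  by rewrite mulr0; apply/eqP; apply: contraNT nk => /fE ->.
have JJ : J *m J = N *: J.
  apply/matrixP => y z; rewrite !mxE (eq_bigr (fun=> 1)) => [|w _]; last by rewrite !mxE mulr1.
  by rewrite sumr_const card_ord mulr1.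
rewrite -/J Jk scalerA; have -> : f k = N; last by rewrite mulVf // scale1r.
have /spectral_fun_eq/(_ i) : F (fun s => f s * f s) = F (fun s => N * f s).
  by rewrite -spectral_fun_mul -spectral_funZ -JE.
by move/(mulIf nzi); rewrite kE.
Qed.

Lemma primitive_idempotents_exist : exists E : 'I_D.+1 -> 'M[C]_#|T|, primitive_idempotents E.
Proof.
have [ks EJ] := spectral_all_ones.
(* The valency comes first so that the idempotent of index 0 is |X|^-1 J. *)
pose rs := k :: rem k (undup spectrum).
have rsE : perm_eq rs (undup spectrum).
  by rewrite perm_sym perm_to_rem ?mem_undup.
have urs : uniq rs by rewrite (perm_uniq rsE) undup_uniq.
have mem_rs : rs =i spectrum by move=> s; rewrite (perm_mem rsE) mem_undup.
(* The index bound [m] stays a parameter until the number of distinct eigenvalues is known to be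
   [D.+1]. *)
pose U m (i : 'I_m) := F (fun s => (s == rs`_i)%:R).
have resolution m f : size rs = m -> F f = \sum_(i < m) f rs`_i *: U m i.
  move=> <-; rewrite spectral_fun_sum; apply: spectral_fun_in => s.
  rewrite -mem_rs => /(nthP 0)[j jr <-].
  rewrite (bigD1 (Ordinal jr)) //= eqxx mulr1 big1 ?addr0 // => i ni.
  by rewrite nth_uniq // eq_sym (_ : (_ == _) = false) ?mulr0 //; apply/negbTE.
have spanU m : size rs = m -> forall B, BM B <-> B \in <<codom (U m)>>%VS.
  move=> rsm B; split=> [/bose_mesner_spectral[f ->]|/span_codomP[c ->]]; last first.
    by apply: bose_mesner_sum => i _; apply/bose_mesnerZ/spectral_delta_bose_mesner.
  by apply/span_codomP; exists (fun i : 'I_m => f rs`_i); apply: resolution.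
have in_rs i : (i < size rs)%N -> exists j, sp 0 j = rs`_i.
  move=> ir; have := mem_nth 0 ir; rewrite mem_rs => /mapP[j _ ->]; by exists j.
have freeU m : size rs = m -> free (codom (U m)).
  move=> <-; apply/free_codomP => c; rewrite spectral_fun_sum => c0 i.
  have [j jE] := in_rs i (ltn_ord i).
  have /spectral_fun_eq/(_ j) : F (fun s => \sum_i0 c i0 * (s == rs`_i0)%:R) = F (fun=> 0).
    rewrite c0 -[LHS](scale0r (F (fun=> 0))) spectral_funZ.
    by apply/spectral_fun_eq => i'; rewrite mul0r.
  rewrite (bigD1 i) //= jE eqxx mulr1 big1 ?addr0 // => i' ni.
  by rewrite nth_uniq // eq_sym (_ : (_ == _) = false) ?mulr0 //; apply/negbTE.
pose V (i : 'I_D.+1) := A i.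
have freeV : free (codom V).
  apply/free_codomP => c c0 i; pose c' h := c (inord h).
  have : fmx c' = fmx (fun=> 0).
    rewrite distance_function_sum -[RHS](_ : 0 = _); last first.
      by apply/matrixP => y z; rewrite !mxE.
    by rewrite -[RHS]c0; apply: eq_bigr => j _; rewrite /c' inord_val.
  move/(distance_function_inj He Hp x) => /(_ i); rewrite /c' inord_val; apply.
  by rewrite -ltnS.
have spanV B : BM B <-> B \in <<codom V>>%VS.
  split=> [/(bose_mesner_distance_function He Hp)[s ->]|/span_codomP[c ->]].
    by apply/span_codomP; exists (fun i : 'I_D.+1 => s i); rewrite distance_function_sum.
  apply: bose_mesner_sum => i _; apply/bose_mesnerZ/(bose_mesner_dist_mx C He Hp x).
  by rewrite -ltnS.
(* The eigenprojections and A_0, ..., A_D are two bases of the same algebra. *)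
have rsD : size rs = D.+1.
  have UV : <<codom (U (size rs))>>%VS = <<codom V>>%VS.
    by apply/vspaceP => B; apply/idP/idP => [/(spanU _ erefl)/spanV|/spanV/(spanU _ erefl)].
  have := freeU _ erefl; have := freeV.
  by rewrite /free UV !size_codom !card_ord => /eqP -> /eqP.
exists (U D.+1); split.
- exact: freeU.
- by move=> B; apply: spanU.
- move=> i y z.
  have [s sE] : exists s, U D.+1 i = fmx s.
    exact: (bose_mesner_distance_function He Hp (spectral_delta_bose_mesner _)).
  (* The idempotent is Hermitean, and symmetric as a function of the distance, so its entries are
     real. *)
  have /matrixP/(_ y z) := spectral_fun_conj (A 1) (fun s => conjC_nat C (s == rs`_i)).
  rewrite -/(U D.+1 i) mxE => yz; apply/CrealP; rewrite yz sE !mxE (dist_sym He) //.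
- move=> i.
  have [s sE] : exists s, U D.+1 i = fmx s.
    exact: (bose_mesner_distance_function He Hp (spectral_delta_bose_mesner _)).
  by rewrite sE; apply/matrixP => y z; rewrite !mxE (dist_sym He).
- move=> i j; rewrite /U spectral_fun_mul.
  case: eqP => [->|/eqP nij].
    by apply/spectral_fun_eq => l; case: (_ == _); rewrite ?mulr1 ?mulr0.
  rewrite -[RHS](scale0r (F (fun=> 0))) spectral_funZ; apply/spectral_fun_eq => l.
  have [->|_] := eqVneq (sp 0 l) rs`_i; last by rewrite !mul0r.
  by rewrite nth_uniq ?rsD // val_eqE (negPf nij) mulr0 mul0r.
- rewrite -(spectral_fun1 (A 1)) (resolution D.+1) //.
  by apply: eq_bigr => i _; rewrite scale1r.
- by rewrite /U /= EJ.
Qed.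

End Existence.

Theorem theorem18 (R : realType) (T : finType) (e : rel T)
    (He : connected_simple_graph e)
    (Hdr : distance_regular e)
    (Hprim : primitive e)
    (HD : (3 <= diameter e)%N)
    (x : T) :
  Q_polynomial R[i] e <-> \det (gram R[i] e x) = 0.
Proof.
have [p Hp] := Hdr.
have HD1 : (1 <= diameter e)%N by lia.
rewrite gram_det0_relation; split=> [[E HE EQ]|[b [b0 b_neq0 b_rel]]].
  exact: (relation_of_Q_polynomial He Hp Hprim HD x HE EQ).
(* The converse starts from an arbitrary system of idempotents, which is reordered later. *)
have [E HE] := primitive_idempotents_exist R[i] He Hp HD1 x.
exact: (Q_polynomial_of_relation He Hp Hprim HD HE b_rel b0 b_neq0).
Qed.
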